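(* Let $(\Omega,\mathcal F,\mathbb P)$ be an atomless probability space. Consider the optimization problem $$\min_{\mathbf a\in A}\mathcal V(g(\mathbf X,\mathbf a)),$$ where $A$ is a set of actions, $\mathcal V:L^\infty\to(-\infty,\infty]$ is the objective functional, $\mathbf X$ is a $d$-dimensional random vector of risks, and $g:\mathbb R^d\times A\to\mathbb R$ is a function representing the portfolio value. This optimization problem is a mean-ES optimization if and only if its objective $\mathcal V$ satisfies [M] and [$p$-CA] for some $p\in(0,1)$.
   Context: $(\Omega,\mathcal F,\mathbb P)$ is atomless; $L^\infty$ is the space of essentially bounded random variables. ''Increasing'' means non-strictly increasing. $X\overset{d}{=}Y$ means equality in law. For $p\in(0,1)$, $\mathrm{VaR}_p(X)=\inf\{x\in\mathbb R:\mathbb P(X\le x)\ge p\}$ and $\mathrm{ES}_p(X)=\frac1{1-p}\int_p^1\mathrm{VaR}_s(X)\,ds$. For a risk measure $\rho$ on $L^\infty$, the optimization problem is called a mean-$\rho$ optimization if $\mathcal V$ is determined by $\mathbb E$ and $\rho$ and is increasing in both, i.e. $\mathcal V(X)=f(\rho(X),\mathbb E[X])$ for all $X\in L^\infty$, for some $(-\infty,\infty]$-valued function $f$, defined on the set of values of $(\rho,\mathbb E)$, that is increasing in each of its arguments. (Constraints are incorporated into $A$ or into $\mathcal V$, e.g. by letting $\mathcal V=\infty$ on violating positions.) It is a mean-ES optimization if it is a mean-$\mathrm{ES}_p$ optimization for some $p\in(0,1)$. (For $\rho=\mathrm{ES}_p$ the set of values of $(\mathrm{ES}_p,\mathbb E)$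 is $\{(x,y)\in\mathbb R^2:x\ge y\}$.) A tail event of a random variable $X$ is an event $B\in\mathcal F$ with $0<\mathbb P(B)<1$ such that $X(\omega)\ge X(\omega')$ for a.s. all $\omega\in B$ and $\omega'\in B^c$. A $p$-tail event of $X$ is a tail event of $X$ with probability $1-p$. A random vector is $p$-concentrated if its components share a common $p$-tail event. [M]: $\mathcal V(X)\le\mathcal V(Y)$ whenever $X\le Y$ pointwise. [$p$-CA]: $\mathcal V(X+Y)\le\mathcal V(X'+Y')$ for all $X,Y,X',Y'\in L^\infty$ such that $(X',Y')$ is $p$-concentrated, $X\overset{d}{=}X'$ and $Y\overset{d}{=}Y'$. *)

(* Defs.v *)
From HB Require Import structures.
From mathcomp Require Import all_boot all_order all_algebra.
From mathcomp Require Import all_classical all_reals all_analysis.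
Set Implicit Arguments.
Unset Strict Implicit.
Unset Printing Implicit Defensive.
Import Order.TTheory GRing.Theory Num.Theory.
Import numFieldNormedType.Exports.
Local Open Scope classical_set_scope.
Local Open Scope ring_scope.

Definition atomless (disp : measure_display) (Omega : measurableType disp)
    (R : realType) (P : probability Omega R) : Prop :=
  forall A : set Omega, measurable A -> (0 < P A)%E ->
  exists B : set Omega,
    [/\ measurable B, B `<=` A, (0 < P B)%E & (P B < P A)%E].

(* Elements are functions, not classes modulo almost sure equality: pointwise
   comparisons below are meaningful. *)
Notation Linf P := (LfunType P (leey 1%E)).

Section RiskFunctionals.
Context (disp : measure_display) (Omega : measurableType disp) (R : realType)
  (P : probability Omega R).
Implicit Types (X Y : Linf P) (B : set Omega) (p : R).

Definition mean X : R := fine 'E_P[X].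

(* Meant for 0 < p < 1, where the set is nonempty and bounded below; [inf] is
   real-valued. *)
Definition VaR p X : R :=
  inf [set x : R | (p%:E <= cdf (X : {RV P >-> R}) x)%E].

Definition ES p X : R :=
  (1 - p)^-1 * \int[lebesgue_measure]_(s in `[p, 1]) VaR s X.

(* Restricted to measurable sets: [P] is unspecified on the others. *)
Definition eq_law X Y : Prop :=
  forall A : set R, measurable A -> distribution P X A = distribution P Y A.

Definition tail_event X B : Prop :=
  [/\ measurable B, (0 < P B)%E, (P B < 1)%E &
      {near almost_everywhere P & almost_everywhere P,
        forall w w', B w -> ~ B w' -> X w' <= X w}].

Definition p_tail_event p X B : Prop :=
  tail_event X B /\ P B = (1 - p)%:E.

Definition p_concentrated p X Y : Prop :=
  exists B, p_tail_event p X B /\ p_tail_event p Y B.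

Definition axiom_M (V : Linf P -> \bar R) : Prop :=
  forall X Y, (forall w, X w <= Y w) -> (V X <= V Y)%E.

Definition axiom_CA p (V : Linf P -> \bar R) : Prop :=
  forall X Y X' Y', p_concentrated p X' Y' -> eq_law X X' -> eq_law Y Y' ->
    (V (X + Y)%R <= V (X' + Y')%R)%E.

End RiskFunctionals.

(* Minimize [objective] of [portfolio (risks w) a] over [a : action]. The field
   [portfolio_Linf] makes this position an element of the domain of the
   objective. Constraints are encoded by the value +oo. *)
Record optimization_problem (disp : measure_display)
    (Omega : measurableType disp) (R : realType) (P : probability Omega R) :=
  OptimizationProblem {
    dim : nat;
    risks : {RV P >-> dim.-tuple R};
    action : Type;
    portfolio : dim.-tuple R -> action -> R;
    portfolio_Linf :
      forall a, (fun w => portfolio (risks w) a) \in Lfun P +oo%E;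
    objective : Linf P -> \bar R;
    objective_gtNy : forall X, (-oo < objective X)%E
  }.

Section MeanRiskOptimization.
Context (disp : measure_display) (Omega : measurableType disp) (R : realType)
  (P : probability Omega R).
Implicit Types (pb : optimization_problem P) (rho : Linf P -> R).

Definition position pb (a : action pb) : Linf P :=
  Lfun_Sub (leey 1%E) (portfolio_Linf a).

Definition minimizers pb : set (action pb) :=
  [set a | forall b : action pb,
    (objective pb (position a) <= objective pb (position b))%E].

Definition mean_risk_values rho : set (R * R) :=
  range (fun X : Linf P => (rho X, mean X)).

(* [f] is a total function, of which only the values on [mean_risk_values rho]
   matter. *)
Definition mean_risk_optimization rho pb : Prop :=
  exists f : R -> R -> \bar R,
    [/\ forall x y, mean_risk_values rho (x, y) -> (-oo < f x y)%E,
        forall x x' y, mean_risk_values rho (x, y) ->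
          mean_risk_values rho (x', y) -> x <= x' -> (f x y <= f x' y)%E,
        forall x y y', mean_risk_values rho (x, y) ->
          mean_risk_values rho (x, y') -> y <= y' -> (f x y <= f x y')%E &
        forall X : Linf P, objective pb X = f (rho X) (mean X)].

Definition mean_ES_optimization pb : Prop :=
  exists p : R, 0 < p < 1 /\ mean_risk_optimization (ES p) pb.

End MeanRiskOptimization.

(* Main.v *)
Require Import Defs.
From HB Require Import structures.
From mathcomp Require Import all_boot all_order all_algebra.
From mathcomp Require Import all_classical all_reals all_analysis.
From mathcomp Require Import measurable_realfun ess_sup_inf ring lra.
Set Implicit Arguments.
Unset Strict Implicit.
Unset Printing Implicit Defensive.
Import Order.TTheory GRing.Theory Num.Theory.
Import numFieldNormedType.Exports.
Local Open Scope classical_set_scope.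
Local Open Scope ring_scope.

(** Expected Shortfall is an integral over a tail event: if B is a p-tail event of
    X then (1 - p) ES_p(X) = E[X; B], and E[X; C] <= (1 - p) ES_p(X) for every C
    with P(C) = 1 - p. Hence ES_p is subadditive, and additive on p-concentrated
    pairs, which makes every mean-ES objective satisfy [M] and [p-CA].

    Conversely, [p-CA] applied in both directions says that V(X + Y) depends only
    on the marginal laws of a p-concentrated pair (X, Y). Let B be a p-tail event
    of X. First, moving mass inside B (or inside its complement) opens a gap
    between the values of X on B and off B. Then, for U uniform and independent of
    a copy of X, subtracting X from U modulo eta gives U' of the same law as U,
    even given X, and X + U' - U takes only two values on B and two off B. Cut
    into small increments U'/N - U/N that the gap absorbs, the passage from X to
    X + U' - U does not change V. The law of the result depends only on E[X; B] and
    E[X] (and the bands), so V(X) is the value of V at the variable equal to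
    ES_p(X) on B and to a constant off B, with mean E[X]. Monotonicity in the mean
    is [M]; monotonicity in ES_p is one antithetic recoupling of an indicator of
    probability 1/2. No continuity of V is available, so every identity is
    exact. *)

(** * Atomless probability spaces *)

(** Without continuity, averaging X on B by ever finer rearrangements and a passage to the limit is
    out of reach; the rotation reaches, in finitely many exact steps, a law that depends on the
    averages alone. Given X, both U and U' are uniform, so (X, U) and (X, U') have the same joint
    law. Adding the indicator of the tail event to both increments keeps their laws equal and makes
    each of them concentrated with the rest of the sum. The result rounds each value x at random to
    an end of its band, with mean x; the probabilities of rounding are affine in x, which is why
    only E[X; B] and E[X] survive. A uniform variable independent of a given X need not exist, since
    X may generate the whole sigma-algebra; so a pair with the right joint law is rebuilt on Omega,
    and X is replaced by a copy, which is harmless because [p-CA] with Y = 0 makes V law-invariant.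
    No gap opens above the threshold when E[X; B] is the threshold times P(B); then one tries the
    complement, and if that fails too, X is almost surely constant. Probability 1/2 in the last step
    is what gives an indicator and that of the complementary event the same law. *)

Section Prob.
Context (disp : measure_display) (Omega : measurableType disp) (R : realType)
  (P : probability Omega R).
Implicit Types (A B : set Omega).

Definition Pr A : R := fine (P A).

Lemma PrE A : measurable A -> P A = (Pr A)%:E.
Proof. by move=> mA; rewrite /Pr fineK// fin_num_measure. Qed.

Lemma Pr_ge0 A : 0 <= Pr A.
Proof. exact/fine_ge0. Qed.

Lemma le_Pr A B : measurable A -> measurable B -> A `<=` B -> Pr A <= Pr B.
Proof.
by move=> mA mB AB; rewrite -lee_fin -!PrE// le_measure// inE.
Qed.

Lemma PrT : Pr setT = 1.
Proof. by rewrite /Pr probability_setT. Qed.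

Lemma Pr0 : Pr set0 = 0.
Proof. by rewrite /Pr measure0. Qed.

Lemma Pr_le1 A : measurable A -> Pr A <= 1.
Proof. by move=> mA; rewrite -PrT le_Pr. Qed.

Lemma PrDI A B : measurable A -> measurable B ->
  Pr A = Pr (A `\` B) + Pr (A `&` B).
Proof.
move=> mA mB; apply: EFin_inj.
rewrite EFinD -!PrE//; [|exact: measurableI|exact: measurableD].
by rewrite -measureDI.
Qed.

Lemma PrU A B : measurable A -> measurable B -> A `&` B = set0 ->
  Pr (A `|` B) = Pr A + Pr B.
Proof.
move=> mA mB AB0; apply: EFin_inj.
rewrite EFinD -!PrE//; last exact: measurableU.
by rewrite measureU.
Qed.

Lemma PrC A : measurable A -> Pr (~` A) = 1 - Pr A.
Proof.
move=> mA; apply: EFin_inj.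
by rewrite EFinB -!PrE//; [exact: probability_setC|exact: measurableC].
Qed.

Hypothesis atomlessP : atomless P.

(** Of a smaller part of [A] and its complement in [A], one carries at most half of the
    probability. *)
Lemma half_set A : measurable A -> 0 < Pr A ->
  exists B, [/\ measurable B, B `<=` A, 0 < Pr B & Pr B <= Pr A / 2].
Proof.
move=> mA A0; have [|B [mB BA B0 BltA]] := atomlessP mA; first by rewrite PrE// lte_fin.
rewrite PrE// lte_fin in B0; rewrite !PrE// lte_fin in BltA.
have mD : measurable (A `\` B) by exact: measurableD.
have eqA : Pr A = Pr (A `\` B) + Pr B by rewrite (PrDI mA mB) (setIidr BA).
have [le|gt] := leP (Pr B) (Pr A / 2); first by exists B.
by exists (A `\` B); split => //; try exact: subDsetl; lra.
Qed.

Lemma small_set A (e : R) : measurable A -> 0 < Pr A -> 0 < e ->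
  exists B, [/\ measurable B, B `<=` A, 0 < Pr B & Pr B <= e].
Proof.
move=> mA A0 e0.
have iter n : exists B, [/\ measurable B, B `<=` A, 0 < Pr B & Pr B <= (2 ^- n : R)].
  elim: n => [|n [B [mB BA B0 Bn]]].
    by exists A; split => //; rewrite expr0 invr1 Pr_le1.
  have [C [mC CB C0 Cle]] := half_set mB B0.
  exists C; split => //; first exact: subset_trans BA.
  rewrite exprS invfM; lra.
have [n] : exists n : nat, e^-1 < n%:R.
  by exists (Num.bound e^-1); rewrite archi_boundP// invr_ge0 ltW.
move=> en; have [B [mB BA B0 Bn]] := iter n.
exists B; split => //; apply: (le_trans Bn).
rewrite invf_ple ?posrE ?exprn_gt0// (le_trans (ltW en))//.
by rewrite -natrX ler_nat ltnW// ltn_expl.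
Qed.

(* Greedy exhaustion: each step adds an admissible piece whose probability is at
   least half of the largest one available. *)
Lemma sierpinski A (r : R) : measurable A -> 0 <= r <= Pr A ->
  exists B, [/\ measurable B, B `<=` A & Pr B = r].
Proof.
move=> mA /andP[r0 rA].
pose adm B D := [/\ measurable D, D `<=` A `\` B & Pr D <= r - Pr B].
pose good B := [/\ measurable B, B `<=` A & Pr B <= r].
have stepE B : exists C, good B ->
    [/\ good C, B `<=` C & forall D, adm B D -> Pr D <= 2 * (Pr C - Pr B)].
  have [gB|?] := pselect (good B); last by exists B.
  have [mB BA Br] := gB.
  pose S := [set Pr D | D in adm B].
  have S0 : S 0 by exists set0; [split => //; rewrite Pr0 subr_ge0|exact: Pr0].
  have hS : has_sup S.
    by split; [exists 0|exists (r - Pr B) => _ [D [_ _ ?] <-]].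
  have [D [aD DS]] : exists D, adm B D /\ sup S <= 2 * Pr D.
    have [le0|gt0] := leP (sup S) 0.
      exists set0; split; last by rewrite Pr0 mulr0.
      by split => //; rewrite Pr0 subr_ge0.
    have [|_ [D aD <-] h] := @sup_adherent _ S (sup S / 2) _ hS.
      by rewrite divr_gt0.
    by exists D; split => //; lra.
  have [mD DA Dr] := aD.
  have BD0 : B `&` D = set0.
    by rewrite -subset0 => w [Bw /DA[_ /(_ Bw)]].
  have PU : Pr (B `|` D) = Pr B + Pr D by rewrite PrU.
  exists (B `|` D) => _; split.
  - split; [exact: measurableU| |by rewrite PU; lra].
    by move=> w [/BA//|/DA[]].
  - exact: subsetUl.
  - move=> E aE; rewrite PU addrC addKr (le_trans _ DS)//.
    by apply: ub_le_sup; [case: hS|exists E].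
have [step stepP] := choice stepE.
pose F n := iter n step set0.
have gF n : good (F n).
  elim: n => [|n /stepP[]//]; by split; [exact: measurable0|exact: sub0set|rewrite Pr0].
have mF n : measurable (F n) by case: (gF n).
have FS n : F n `<=` F n.+1 by have [] := stepP _ (gF n).
have nF : nondecreasing_seq F.
  by apply/nondecreasing_seqP => n; exact/subsetPset/FS.
pose B := \bigcup_n F n.
have mB : measurable B by exact: bigcup_measurable.
have BA : B `<=` A by move=> w [n _]; have [_ + _] := gF n; exact.
have Br : Pr B <= r.
  rewrite -lee_fin -PrE//.
  have cv : P \o F @ \oo --> P B by exact: nondecreasing_cvg_mu.
  apply: (cvge_to_le cv); apply: nearW => n /=.
  by have [? _ ?] := gF n; rewrite PrE// lee_fin.
exists B; split => //; apply/eqP; rewrite eq_le Br/= leNgt; apply/negP => Brlt.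
have mAB : measurable (A `\` B) by exact: measurableD.
have AB0 : 0 < Pr (A `\` B).
  have := PrDI mA mB; rewrite (setIidr BA) => ?; lra.
(* A small piece of what is left over was admissible at every step, so each step gained at least
   half of its probability; this cannot go on with total mass 1. *)
have [|D [mD DAB D0 Dle]] := @small_set (A `\` B) (r - Pr B) mAB AB0.
  by rewrite subr_gt0.
have incr n : n%:R * (Pr D / 2) <= Pr (F n).
  elim: n => [|n IH]; first by rewrite mul0r Pr_ge0.
  have [_ _ /(_ D) h] := stepP _ (gF n).
  have FB : F n `<=` B by exact: bigcup_sup.
  have /h : adm (F n) D.
    split => //; first by move=> w /DAB[? nB]; split => // /FB.
    by rewrite (le_trans Dle)// lerD2l lerN2 le_Pr.
  move=> hD; rewrite -natr1 mulrDl mul1r; apply: le_trans (lerD IH (lexx _)) _;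
      change (step (F n)) with (F n.+1) in hD; move: hD;
      move: (Pr (F n.+1)) (Pr (F n)) => x y ?; lra.
pose n := Num.bound (Pr D / 2)^-1.
have hn : (Pr D / 2)^-1 < n%:R.
  by rewrite archi_boundP// invr_ge0 divr_ge0// ltW.
have incrn := incr n; have le1 := Pr_le1 (mF n).
rewrite -(ltr_pM2r (_ : 0 < Pr D / 2)) ?divr_gt0// mulVf in hn; last lra.
lra.
Qed.

End Prob.

(** * Realizing joint laws on an atomless space *)

(** The latest bit comes first: extending a word is a [cons], and an earlier prefix is a [drop]. *)
Fixpoint rprefix (b : nat -> bool) n : seq bool :=
  if n is m.+1 then b m :: rprefix b m else [::].

Lemma size_rprefix b n : size (rprefix b n) = n.
Proof. by elim: n => //= n ->. Qed.

Lemma drop_rprefix b n m : (n <= m)%N -> drop (m - n) (rprefix b m) = rprefix b n.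
Proof.
elim: m => [|m IH]; first by rewrite leqn0 => /eqP ->.
rewrite leq_eqVlt => /orP[/eqP ->|]; first by rewrite subnn drop0.
by rewrite ltnS => nm; rewrite subSn//= IH.
Qed.

Lemma measurable_word d (E : measurableType d) (c : E -> nat -> bool) n
    (S : set (seq bool)) :
  (forall m, (m < n)%N -> measurable [set e | c e m]) ->
  measurable [set e | S (rprefix (c e) n)].
Proof.
elim: n S => [|n IH] S mc /=.
  have [S0|S0] := pselect (S [::]).
    by rewrite (_ : [set e | _] = setT)//; apply/seteqP; split.
  by rewrite (_ : [set e | _] = set0)//; apply/seteqP; split.
have mc' m : (m < n)%N -> measurable [set e | c e m] by move=> mn; apply: mc;
    exact: ltnW.
rewrite (_ : [set e | _] =
    ([set e | c e n] `&` [set e | S (true :: rprefix (c e) n)]) `|`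
    (~` [set e | c e n] `&` [set e | S (false :: rprefix (c e) n)])); last first.
  apply/seteqP; split => e /=; case: (c e n) => //=; try by case=> -[].
      by left.
    by right.
have mcn := mc n (ltnSn n).
apply: measurableU; apply: measurableI => //; [exact: (IH (S \o cons true))|..].
  exact: measurableC.
exact: (IH (S \o cons false)).
Qed.

Section Words.
Context (d : measure_display) (E : measurableType d) (R : realType)
  (Q : probability E R) (c : E -> nat -> bool).
Hypothesis mc : forall n, measurable [set e | c e n].

(** Splitting on the bit that follows [s]; this is the induction step of [same_words]. *)
Lemma Pr_wordS s n (S : set (seq bool)) :
  Pr Q [set e | S (rprefix (c e) (n.+1 + size s)) /\ rprefix (c e) (size s) = s] =
  \sum_(b : bool) Pr Q [set e | S (rprefix (c e) (n + size (b :: s))) /\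
    rprefix (c e) (size (b :: s)) = b :: s].
Proof.
have mw b : measurable [set e | S (rprefix (c e) (n + (size s).+1)) /\
    c e (size s) :: rprefix (c e) (size s) = b :: s].
  rewrite (_ : [set e | _] =
    [set e | (S `&` [set x | drop n x = b :: s]) (rprefix (c e) (n + (size s).+1))]).
    exact: measurable_word.
  by apply/seteqP; split => e /= [Se <-]; split => //;
    rewrite -[X in drop X](addnK (size s).+1) drop_rprefix// leq_addl.
rewrite big_bool/= -PrU; [|exact: mw..|].
  congr Pr; apply/seteqP; split => e /=; rewrite addnS.
    by move=> [Se <-]; rewrite size_rprefix; case: (c e (size s)); [left|right].
  by move=> [|] [? [_ ->]].
by rewrite -subset0 => e /= [[_ [-> _]] [_ []]].
Qed.

End Words.

Section Realize.
Context (disp : measure_display) (Omega : measurableType disp) (R : realType)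
  (P : probability Omega R).
Hypothesis atomlessP : atomless P.
Context (d : measure_display) (E : measurableType d) (Q : probability E R).

(** Inside a cylinder whose word has full length the event is all or nothing; the induction on the
    number of free bits then goes up to the empty word. *)
Lemma same_words (b : Omega -> nat -> bool) (c : E -> nat -> bool) :
  (forall n, measurable [set w | b w n]) -> (forall n, measurable [set e | c e n]) ->
  (forall s, Pr P [set w | rprefix (b w) (size s) = s] =
             Pr Q [set e | rprefix (c e) (size s) = s]) ->
  forall n (S : set (seq bool)),
    P [set w | S (rprefix (b w) n)] = Q [set e | S (rprefix (c e) n)].
Proof.
move=> mb mc bc n S; rewrite !PrE; [congr EFin|by apply: measurable_word..].
have key k s : Pr P [set w | S (rprefix (b w) (k + size s)) /\ rprefix (b w) (size s)
    = s] =
    Pr Q [set e | S (rprefix (c e) (k + size s)) /\ rprefix (c e) (size s) = s].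
  elim: k s => [|k IH] s; last by rewrite !Pr_wordS//; apply: eq_bigr.
  rewrite add0n; have [Ss|nSs] := pselect (S s).
    rewrite (_ : [set w | _] = [set w | rprefix (b w) (size s) = s]); last first.
      by apply/seteqP; split => w /=; [case|move=> ->].
    rewrite bc; congr Pr.
    by apply/seteqP; split => w /=; [move=> ->|case].
  rewrite (_ : [set w | _] = set0) ?Pr0; last first.
    by apply/seteqP; split => w //= [+ e]; rewrite e.
  rewrite (_ : [set w | _] = set0) ?Pr0//.
  by apply/seteqP; split => w //= [+ e]; rewrite e.
have := key n [::]; rewrite addn0/=.
have eqs T (G : T -> Prop) : [set x | G x /\ [::] = [::] :> seq bool] = [set x | G x].
  by apply/seteqP; split => x /=; [case|].
by rewrite !eqs.
Qed.

(* Omega is split along the binary tree, each node receiving the probability of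
   the corresponding cylinder. *)
Lemma realize_bits (c : E -> nat -> bool) :
  (forall n, measurable [set e | c e n]) ->
  exists b : Omega -> nat -> bool, (forall n, measurable [set w | b w n]) /\
  forall n (S : set (seq bool)),
    P [set w | S (rprefix (b w) n)] = Q [set e | S (rprefix (c e) n)].
Proof.
move=> mc.
have splitE (Ar : set Omega * R) : exists B, measurable Ar.1 ->
    0 <= Ar.2 <= Pr P Ar.1 ->
    [/\ measurable B, B `<=` Ar.1 & Pr P B = Ar.2].
  have [[mA rA]|h] := pselect (measurable Ar.1 /\ 0 <= Ar.2 <= Pr P Ar.1).
    by have [B hB] := sierpinski atomlessP mA rA; exists B.
  by exists set0 => *; exfalso; apply: h.
have [split splitP] := choice splitE.
pose C s := [set e | rprefix (c e) (size s) = s].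
have mC s : measurable (C s) by exact: (measurable_word [set s]).
pose fix A s := if s is x :: s' then
  let B := split (A s', Pr Q (C (true :: s'))) in if x then B else A s' `\` B
  else setT.
have C_true s : C (true :: s) `<=` C s by move=> e [].
have C_false s : C (false :: s) = C s `\` C (true :: s).
  rewrite /C; apply/seteqP; split => e /=; first by move=> [-> ->].
  by move=> [Cs nC]; congr (_ :: _) => //; apply/negP => ce; apply: nC; rewrite ce Cs.
have AP s : measurable (A s) /\ Pr P (A s) = Pr Q (C s).
  elim: s => [|x s [mA PA]].
    split; first exact: measurableT.
    by rewrite PrT (_ : C [::] = setT) ?PrT//; apply/seteqP; split.
  have := splitP (A s, Pr Q (C (true :: s))) mA.
  rewrite /= PA Pr_ge0 le_Pr//= => /(_ isT)[mB BA PB].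
  case: x => //; split; first exact: measurableD.
  rewrite C_false; have := PrDI P mA mB; have := PrDI Q (mC s) (mC (true :: s)).
  by rewrite (setIidr BA) (setIidr (C_true s)) PB PA => -> /addIr ->.
have Asub s : A (true :: s) `<=` A s.
  have [mA PA] := AP s.
  have := splitP (A s, Pr Q (C (true :: s))) mA.
  by rewrite /= PA Pr_ge0 le_Pr//= => /(_ isT)[].
(* Bit [n] tests membership in a node named by the earlier bits, so the words are built before the
   bits; [rE] identifies them with the prefixes of [b]. *)
pose fix r w n := if n is m.+1 then `[< A (true :: r w m) w >] :: r w m else [::].
pose b w n := `[< A (true :: r w n) w >].
have rE w n : rprefix (b w) n = r w n by elim: n => //= n ->.
have AE s : A s = [set w | rprefix (b w) (size s) = s].
  elim: s => [|x s IH]; first by apply/seteqP.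
  apply/seteqP; split => w /=.
    move=> Aw.
    have As : A s w by case: x Aw => [/Asub//|[]].
    have rs : rprefix (b w) (size s) = s by move: As; rewrite IH.
    rewrite rs; congr (_ :: _); rewrite /b -rE rs.
    by case: x Aw => [/asboolP//|[_ h]]; apply/asboolP.
  move=> [bx rs]; have As : A s w by rewrite IH.
  move: bx; rewrite /b -rE rs; case: x => [/asboolP//|/asboolP nA].
  by split.
have mb n : measurable [set w | b w n].
  elim/ltn_ind: n => n IH.
  have words : forall k, exists t : seq (seq bool), forall s, size s = k -> s \in t.
    elim => [|k [t ht]]; first by exists [:: [::]] => -[].
    exists ([seq true :: s | s <- t] ++ [seq false :: s |
        s <- t]) => -[//|[] s [/ht st]];
      by rewrite mem_cat map_f ?orbT.
  have [t ht] := words n.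
  rewrite (_ : [set w | _] = \bigcup_(s in [set` t])
      (A (true :: s) `&` [set w | rprefix (b w) n = s])); last first.
    apply/seteqP; split => w /=.
      move=> /asboolP; rewrite -rE => bw; exists (rprefix (b w) n) => //=.
      by apply: ht; rewrite size_rprefix.
    by move=> [s _ [As rs]]; apply/asboolP; rewrite -rE rs.
  apply: fin_bigcup_measurable => // s _.
  apply: measurableI; first by case: (AP (true :: s)).
  exact: (measurable_word [set s] IH).
exists b; split => //; apply: same_words => // s.
by rewrite -AE; have [_ ->] := AP s.
Qed.

End Realize.

(** * Recovering a real number from its comparisons with the rationals *)

Section Decode.
Context (R : realType) (lo hi : R).

Definition cylinders : set (set (nat -> bool)) :=
  [set A | exists n (S : set (seq bool)), A = [set b | S (rprefix b n)]].

Definition bit_space := g_sigma_algebraType cylinders.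

Lemma setI_closed_cylinders : setI_closed cylinders.
Proof.
move=> _ _ [n [S ->]] [m [T ->]].
exists (maxn n m), [set s | S (drop (maxn n m - n) s) /\ T (drop (maxn n m - m) s)].
by apply/seteqP; split => b /=; rewrite !drop_rprefix ?leq_maxl ?leq_maxr.
Qed.

Lemma measurable_bit n : measurable ([set b | b n] : set bit_space).
Proof.
apply: sub_sigma_algebra; exists n.+1, [set s | head true s].
by apply/seteqP; split.
Qed.

(* The value whose position relative to the rationals of [lo, hi] is recorded by
   the bits of index [pickle (i, q)]. *)
Definition decode (i : bool) (b : bit_space) : R :=
  sup [set x | x = lo \/
    exists q : rat, [/\ x = ratr q, lo <= ratr q <= hi & b (pickle (i, q))]].

(** This form turns the supremum into a countable union, whence measurability. The element [lo]
    keeps the set nonempty, so that the supremum is genuine. *)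
Lemma decode_gt i b t : t < decode i b <->
  t < lo \/ exists q : rat, [/\ t < ratr q, lo <= ratr q <= hi & b (pickle (i, q))].
Proof.
rewrite /decode; set S := [set x | _].
have S0 : S !=set0 by exists lo; left.
have hS : has_ubound S.
  by exists (Num.max lo hi) => x [->|[q [-> /andP[_ ?] _]]];
      rewrite le_max ?lexx// orbC; apply/orP; left.
split.
  move=> /(sup_gt S0)[x [->|[q [-> qlh bq]]] tx]; first by left.
  by right; exists q.
move=> [tlo|[q [tq qlh bq]]].
  by rewrite (lt_le_trans tlo)// ub_le_sup//; left.
by rewrite (lt_le_trans tq)// ub_le_sup//; right; exists q.
Qed.

Lemma measurable_decode i : measurable_fun [set: bit_space] (decode i).
Proof.
apply: (measurability _ (RGenOInfty.measurableE R)) => _ [_ [t ->] <-].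
rewrite setTI (_ : _ @^-1` _ = (if t < lo then setT else set0) `|`
  \bigcup_(q : rat) (if (t < ratr q) && (lo <= ratr q <= hi)
                     then [set b : nat -> bool | b (pickle (i, q))] else set0)).
  apply: measurableU; first by case: ifP.
  by apply: bigcupT_measurable_rat => q; case: ifP => // _; exact: measurable_bit.
apply/seteqP; split => b /=; rewrite in_itv/= andbT.
  move=> /decode_gt[tlo|[q [tq qlh bq]]]; first by left; case: ifPn => //; rewrite tlo.
  by right; exists q => //; rewrite tq qlh.
move=> h; apply/decode_gt; case: h => [|[q _]].
  by case: ifPn => // tlo _; left.
by case: ifP => // /andP[tq qlh] bq; right; exists q.
Qed.

Lemma decodeK i b x : lo <= x <= hi -> (forall q, b (pickle (i, q)) = (ratr q < x)) ->
  decode i b = x.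
Proof.
move=> /andP[lox xhi] bE; apply/eqP; rewrite eq_le; apply/andP; split; rewrite leNgt;
    apply/negP.
  move=> /decode_gt[|[q [xq _]]]; first by rewrite ltNge lox.
  by rewrite bE => /(lt_trans xq); rewrite ltxx.
move=> dx; have [lod|dlo] := leP lo (decode i b); last first.
  by have := (decode_gt i b (decode i b)).2 (or_introl dlo); rewrite ltxx.
have [q] := rat_in_itvoo dx; rewrite in_itv/= => /andP[dq qx].
have := (decode_gt i b (decode i b)).2; rewrite ltxx => h; apply: notF; apply: h.
right; exists q; split => //; last by rewrite bE.
by rewrite (le_trans lod (ltW dq)) (le_trans (ltW qx)).
Qed.

End Decode.

Section RealizePair.
Context (disp : measure_display) (Omega : measurableType disp) (R : realType)
  (P : probability Omega R).
Hypothesis atomlessP : atomless P.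
Context (d : measure_display) (E : measurableType d) (Q : probability E R).

(** The pair is encoded by the bits that compare its components with the rationals, the bits are
    realized on [Omega], then decoded. The two laws of bit sequences agree on cylinders, a
    pi-system, hence everywhere. *)
Lemma realize_bounded (h1 h2 : E -> R) (lo hi : R) :
  measurable_fun setT h1 -> measurable_fun setT h2 ->
  (forall e, lo <= h1 e <= hi) -> (forall e, lo <= h2 e <= hi) ->
  exists X U : Omega -> R, [/\ measurable_fun setT X, measurable_fun setT U &
    forall S : set (R * R), measurable S ->
      P [set w | S (X w, U w)] = Q [set e | S (h1 e, h2 e)]].
Proof.
move=> mh1 mh2 h1b h2b.
pose c e n := if unpickle n is Some iq then
    ratr (iq : bool * rat).2 < (if iq.1 then h1 e else h2 e) else false.
have mc n : measurable [set e | c e n].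
  rewrite /c; case: (unpickle n) => [[i q]|]/=; last first.
    by rewrite (_ : [set _ | _] = set0)//; apply/seteqP; split.
  have mi : measurable_fun setT (if i then h1 else h2) by case: i.
  rewrite (_ : [set e | _] = setT `&` (if i then h1 else h2) @^-1` `]ratr q, +oo[).
    exact: mi.
  by rewrite setTI; apply/seteqP; split => e /=; rewrite in_itv/= andbT; case: (i).
have [b [mb bc]] := realize_bits atomlessP Q mc.
pose D (i : bool) := @decode R lo hi i.
have hD e : h1 e = D true (c e) /\ h2 e = D false (c e).
  by split; apply/esym/decodeK => // q; rewrite /c pickleK.
have mbT d' (T : measurableType d') (f : T -> bit_space) :
    (forall n, measurable [set x | f x n]) -> measurable_fun setT f.
  move=> mf; apply: (@measurability _ _ T bit_space setT f cylinders)
      => // _ [_ [n [S ->]] <-].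
  rewrite setTI; exact: measurable_word.
have mbs : measurable_fun setT (b : Omega -> bit_space) by exact: mbT.
have mcs : measurable_fun setT (c : E -> bit_space) by exact: mbT.
have mD i := measurable_decode lo hi i.
exists (D true \o b), (D false \o b); split; [exact: measurableT_comp..|].
move=> S mS.
have mDS : measurable ((fun x => (D true x, D false x)) @^-1` S : set bit_space).
  rewrite -[X in measurable X]setTI.
  by apply: (measurable_fun_pair (mD true) (mD false)).
pose B : {mfun Omega >-> bit_space} := mfun_Sub (mem_set mbs).
pose C : {mfun E >-> bit_space} := mfun_Sub (mem_set mcs).
rewrite (_ : [set e | _] = (c : E -> bit_space) @^-1`
    ((fun x => (D true x, D false x)) @^-1` S)); last first.
  by apply/seteqP; split => e /=; have [-> ->] := hD e.
suff : distribution P B ((fun x => (D true x, D false x)) @^-1` S) =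
    distribution Q C ((fun x => (D true x, D false x)) @^-1` S) by [].
apply: (@measure_unique _ R bit_space cylinders (fun=> setT) _ _ _ _
  (distribution P B) (distribution Q C)) => //.
- exact: setI_closed_cylinders.
- by move=> i; exists 0%N, setT; apply/seteqP; split.
- by apply/seteqP; split => // x _; exists 0%N.
- by move=> _ [n [T ->]]; exact: bc.
- by move=> _; rewrite [ltLHS](probability_setT (distribution P B)) ltry.
Qed.

(** Equality of laws gives the constraint [S0] only almost surely. It is made to hold at every point
    by substituting one value of [(h1, h2)] on the exceptional null set, because tail events are
    later handled pointwise. *)
Lemma realize (h1 h2 : E -> R) (lo hi : R) (S0 : set (R * R)) :
  measurable_fun setT h1 -> measurable_fun setT h2 ->
  (forall e, lo <= h1 e <= hi) -> (forall e, lo <= h2 e <= hi) ->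
  measurable S0 -> (forall e, S0 (h1 e, h2 e)) ->
  exists X U : Omega -> R, [/\ measurable_fun setT X, measurable_fun setT U,
    forall w, S0 (X w, U w) &
    forall S : set (R * R), measurable S ->
      P [set w | S (X w, U w)] = Q [set e | S (h1 e, h2 e)]].
Proof.
move=> mh1 mh2 h1b h2b mS0 hS0.
have [X [U [mX mU XU]]] := realize_bounded mh1 mh2 h1b h2b.
have [e0 _] : exists e : E, True.
  apply: contrapT => noE; have := probability_setT Q.
  rewrite (_ : setT = set0); first by rewrite measure0 => /eqP;
      rewrite eqe eq_sym oner_eq0.
  by apply/seteqP; split => // e _; apply: noE; exists e.
pose G := [set w | S0 (X w, U w)].
have mpair S : measurable S -> measurable [set w | S (X w, U w)].
  move=> mS; rewrite -[X in measurable X]setTI.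
  exact: (measurable_fun_pair mX mU).
have mG : measurable G by exact: mpair.
have PG : P (~` G) = 0%E.
  rewrite probability_setC// XU//.
  have -> : [set e | S0 (h1 e, h2 e)] = setT by apply/seteqP; split=> // e _;
      exact: hS0.
  by rewrite probability_setT subee.
exists (fun w => if w \in G then X w else h1 e0), (fun w => if w \in G then U w else
    h2 e0).
have mif (f : Omega -> R) k : measurable_fun setT f ->
    measurable_fun setT (fun w => if w \in G then f w else k).
  move=> mf; apply: measurable_fun_ifT => //.
  by apply: (measurable_fun_bool true); rewrite setTI (_ : _ @^-1` _ = G)//;
    apply/seteqP; split => w /=; [exact: set_mem|exact: mem_set].
split; [exact: mif..| |].
  by move=> w; case: ifPn; rewrite ?inE.
move=> S mS; rewrite -XU//.
have eqG : [set w | S (if w \in G then X w else h1 e0, if w \in G then U w else h2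
    e0)] `&` G =
    [set w | S (X w, U w)] `&` G.
  by apply/seteqP; split => w [/= + Gw]; rewrite mem_set.
have m1 : measurable [set w | S (if w \in G then X w else h1 e0, if w \in G then U w
    else h2 e0)].
  rewrite -[X in measurable X]setTI.
  exact: (measurable_fun_pair (mif _ _ mX) (mif _ _ mU)).
have full A : measurable A -> P A = P (A `&` G).
  move=> mA; rewrite (measureDI P mA mG) (@subset_measure0 _ _ _ P (A `\` G) (~` G))
      ?add0e//.
  - exact: measurableD.
  - exact: measurableC.
by rewrite full// [RHS]full ?eqG//; exact: mpair.
Qed.

End RealizePair.

(** * Quantiles *)

Lemma prob_ray_eq (R : realType) (m1 m2 : probability R R) :
  (forall t : R, m1 `]t, +oo[%classic = m2 `]t, +oo[%classic) ->
  forall A : set R, measurable A -> m1 A = m2 A.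
Proof.
move=> h; apply: (@measure_unique _ R R (@RGenOInfty.G R)
    (fun n => `]-n%:R, +oo[%classic)).
- exact: RGenOInfty.measurableE.
- move=> _ _ [x ->] [y ->]; exists (Num.max x y).
  by apply/seteqP; split => z /=; rewrite !in_itv/= !andbT gt_max => /andP.
- by move=> n; exists (- n%:R).
- apply/seteqP; split => // x _; exists (Num.bound `|x|) => //=.
  by have := archi_boundP (normr_ge0 x); rewrite ltr_norml in_itv/= andbT => /andP[].
- by move=> _ [x ->]; exact: h.
- by move=> k; rewrite (le_lt_trans (probability_le1 _ _)) ?ltry.
Qed.

Section Quantile.
Context (d : measure_display) (Omega : measurableType d) (R : realType)
  (P : probability Omega R).
Variable X : {RV P >-> R}.

(** The formula of [VaR], for an arbitrary real random variable. *)
Definition quantile (s : R) : R := inf [set x : R | (s%:E <= cdf X x)%E].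

(** The Galois connection between quantile and distribution function: right-continuity of the latter
    makes the infimum attained. *)
Lemma quantile_le s t : 0 < s < 1 -> (quantile s <= t) = (s%:E <= cdf X t)%E.
Proof.
move=> /andP[s0 s1]; rewrite /quantile; set S := [set x | _].
have cdfE x : cdf X x = (fine (cdf X x))%:E by rewrite fineK// fin_num_measure.
have [x Sx] : S !=set0.
  have h : fine \o cdf X @ +oo%R --> (1 : R) by exact/fine_cvg/cvg_cdfy1.
  have [x /= sx] := filter_ex (cvgr_gt _ h _ s1).
  by exists x; rewrite /S/= cdfE lee_fin ltW.
have [y ny] : exists y, lbound S y.
  have h : fine \o cdf X @ -oo%R --> (0 : R) by exact/fine_cvg/cvg_cdfNy0.
  have [y /= sy] := filter_ex (cvgr_lt _ h _ s0).
  exists y => z; rewrite /S/= leNgt => sz; rewrite leNgt; apply/negP => zy.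
  move/negP: sz; apply; rewrite (le_lt_trans (cdf_nondecreasing _ (ltW zy)))//.
  by rewrite cdfE lte_fin.
apply/idP/idP => [qt|]; last by move=> St; apply: ge_inf => //; exists y.
have rc := @cdf_right_continuous _ _ _ P X t.
apply: (cvge_to_ge rc); near=> z.
have tz : t < z by near: z; exact: nbhs_right_gt.
have [u Su uz] : exists2 u, S u & u < z.
  have hS : has_inf S by split; [exists x|exists y].
  by have [|u Su uz] := @inf_adherent _ S (z - t) _ hS; rewrite ?subr_gt0//;
      exists u => //; lra.
by rewrite (le_trans Su)// cdf_nondecreasing// ltW.
Unshelve. all: by end_near. Qed.

(* Outside ]0, 1[ the infimum may be that of an empty or unbounded set. *)
Definition uquantile (s : R) : R := if 0 < s < 1 then quantile s else 0.

Lemma measurable_uquantile : measurable_fun [set: measurableTypeR R] uquantile.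
Proof.
apply: (measurability _ (RGenOInfty.measurableE R)) => _ [_ [t ->] <-].
rewrite setTI (_ : _ @^-1` _ = (`]0, 1[%classic `&` `]fine (cdf X t), +oo[%classic) `|`
   (~` `]0, 1[%classic `&` (if t < 0 then setT else set0))).
  apply: measurableU; apply: measurableI => //; first exact: measurableC.
  by case: ifP.
apply/seteqP; split => s; rewrite /uquantile /= !in_itv/= !andbT.
  case: ifPn => s01; last by move=> t0; right; rewrite t0.
  rewrite ltNge quantile_le// -ltNge => h; left; split => //.
  by rewrite -lte_fin fineK// fin_num_measure.
move=> [[s01 h]|[/negP/negbTE -> ]]; last by case: ifPn.
rewrite s01 ltNge quantile_le// -ltNge.
by rewrite -[cdf X t]fineK ?lte_fin// fin_num_measure.
Qed.

Definition unif01 : probability (measurableTypeR R) R := uniform_prob (@ltr01 R).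

(** The endpoint 1 is a null set, and the half-open interval is the one that rotations modulo 1 map
    bijectively to itself. *)
Lemma unif01E A : measurable A ->
  unif01 A = lebesgue_measure (A `&` `[0, 1[).
Proof.
move=> mA; rewrite /unif01/= /uniform_prob integral_uniform_pdf.
rewrite (eq_integral (fun=> 1%E)); last first.
  move=> x; rewrite inE/= in_itv/= => -[_ x01].
  by rewrite /uniform_pdf x01 subr0 invr1.
rewrite integral_cst ?mul1e/=; last exact: measurableI.
rewrite -[in LHS](@setUitv1 _ _ (BLeft 0) 1 true)//; last by rewrite bnd_simp.
rewrite setIUr measureU0//; first exact: measurableI.
  exact: measurableI.
apply: (subset_measure0 _ _ (@subIsetr _ _ _) (lebesgue_measure_set1 _)) => //.
  exact: measurableI.
Qed.

(** Inverse transform sampling: by [quantile_le] the quantile at [s] exceeds [t] exactly when [s]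
    exceeds the distribution function at [t]. *)
Lemma law_uquantile A : measurable A ->
  unif01 (uquantile @^-1` A) = distribution P X A.
Proof.
move=> mA.
pose q : {mfun measurableTypeR R >-> R} :=
    @mfun_Sub _ _ (measurableTypeR R) R uquantile (mem_set measurable_uquantile).
suff : distribution unif01 q A = distribution P X A by [].
apply: prob_ray_eq mA => t /=.
have F1 : (cdf X t <= 1)%E := cdf_le1 X t.
have F0 := cdf_ge0 X t.
have FE : cdf X t = (fine (cdf X t))%:E by rewrite fineK// fin_num_measure.
transitivity (1 - cdf X t)%E; last first.
  have /eqP := cdf_ccdf_1 X t; rewrite /ccdf => /eqP <-.
  by rewrite FE addeAC subee// add0e.
rewrite FE; move: (fine _) FE => F FE.
rewrite FE !lee_fin in F0; rewrite FE -[1%E]/(1%:E) lee_fin in F1.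
have mq : measurable (uquantile @^-1` `]t, +oo[).
  by rewrite -[X in measurable X]setTI; exact: measurable_uquantile.
rewrite [LHS]unif01E//.
transitivity (lebesgue_measure (`]F, 1[%classic : set R)); last first.
  rewrite lebesgue_measure_itv/= lte_fin; case: ifPn => [//|].
  by rewrite -leNgt => h; have -> : F = 1 by [apply/eqP; rewrite eq_le F1];
      rewrite subee.
(* At the point 0 of the interval [uquantile] takes its default value; this point is negligible. *)
rewrite (_ : _ `&` _ = `]F, 1[ `|` (uquantile @^-1` `]t, +oo[ `&` [set 0])).
  apply: measureU0 => //; first exact: measurableI.
  apply: (subset_measure0 _ _ (@subIsetr _ _ _) (lebesgue_measure_set1 _)) => //.
  exact: measurableI.
apply/seteqP; split => s; rewrite /uquantile /= !in_itv/= !andbT.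
  move=> [+ /andP[]]; rewrite le_eqVlt => qt /predU1P[s0|s0] s1; first by right.
  move: qt.
  by rewrite s0 s1/= ltNge quantile_le ?s0// FE lee_fin -ltNge => Fs; left; rewrite Fs.
move=> [/andP[Fs s1]|[qt s0]]; last by split => //; rewrite s0 lexx ltr01.
have s0 : 0 < s by exact: le_lt_trans Fs.
split; last by rewrite ltW.
by rewrite s0 s1 ltNge quantile_le ?s0// FE lee_fin -ltNge.
Qed.

End Quantile.

(** * Tail events *)

(** A threshold instead of the pairwise comparison of [tail_event], and at every point instead of
    almost surely: the constructions below modify functions pointwise. *)
Definition separates (T : Type) (R : realType) (B : set T) (X : T -> R) (k : R) :=
  (forall w, B w -> k <= X w) /\ (forall w, ~ B w -> X w <= k).

Section Tail.
Context (d : measure_display) (Omega : measurableType d) (R : realType)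
  (P : probability Omega R).
Variable X : {RV P >-> R}.
Variable p : R.
Hypothesis p01 : 0 < p < 1.

Lemma measurable_RV_itv (i : interval R) : measurable [set w | X w \in i].
Proof. exact: (measurable_funPTI X (measurable_itv i)). Qed.

Lemma cdf_Pr t : cdf X t = (Pr P [set w | X w <= t])%:E.
Proof.
rewrite -PrE; last exact: (measurable_RV_itv `]-oo, t]).
by [].
Qed.

(** Continuity from below: at each level strictly under the quantile the distribution function is
    less than [p]. *)
Lemma Pr_lt_quantile : Pr P [set w | X w < quantile X p] <= p.
Proof.
rewrite -lee_fin -PrE; last exact: (measurable_RV_itv `]-oo, quantile X p[).
pose F n := [set w | X w <= quantile X p - n.+1%:R^-1].
have mF n : measurable (F n) by exact: (measurable_RV_itv `]-oo, quantile X p -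
    n.+1%:R^-1]).
have -> : [set w | X w < quantile X p] = \bigcup_n F n.
  apply/seteqP; split => w /=; last first.
    by move=> [n _]; rewrite /F/= => /le_lt_trans; apply;
        rewrite ltrBlDr ltrDl invr_gt0.
  rewrite -subr_gt0 => h; have [n hn] := ltr_add_invr (y := 0) h.
  by exists n => //; rewrite /F/=; rewrite lerBrDl -lerBrDr ltW// -[ltLHS]add0r.
have cv : P \o F @ \oo --> P (\bigcup_n F n).
  apply: nondecreasing_cvg_mu => //; first exact: bigcup_measurable.
  move=> n m nm; apply/subsetPset => w; rewrite /F/= => /le_trans; apply.
  by rewrite lerD2l lerN2 lef_pV2 ?posrE// ler_nat.
apply: (cvge_to_le cv); apply: nearW => n /=.
rewrite (PrE P (mF n)) lee_fin leNgt; apply/negP => h.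
have : quantile X p <= quantile X p - n.+1%:R^-1.
  by rewrite quantile_le// cdf_Pr lee_fin ltW.
by rewrite lerDl oppr_ge0 leNgt invr_gt0 ltr0n.
Qed.

(** If the law of [X] has an atom at the quantile, the event where [X] exceeds it may be too small;
    a piece of the event where [X] equals it, of the exact missing probability, is then adjoined. *)
Lemma exists_tail : atomless P ->
  exists B k, [/\ measurable B, Pr P B = 1 - p & separates B X k].
Proof.
move=> aP; set k := quantile X p.
have mle : measurable [set w | X w <= k] := measurable_RV_itv `]-oo, k].
have mlt : measurable [set w | X w < k] := measurable_RV_itv `]-oo, k[.
have mgt : measurable [set w | k < X w].
  have := measurable_RV_itv `]k, +oo[.
  by congr measurable; apply/seteqP; split => w /=; rewrite in_itv/= andbT.
have meq : measurable [set w | X w = k].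
  have := measurable_RV_itv `[k, k].
  congr measurable; apply/seteqP; split => w /=; rewrite in_itv/=.
    by move=> ?; apply/eqP; rewrite eq_le andbC.
  by move=> ->; rewrite lexx.
have Fk : p <= Pr P [set w | X w <= k].
  by rewrite -lee_fin -cdf_Pr -quantile_le.
have Pgt : Pr P [set w | k < X w] = 1 - Pr P [set w | X w <= k].
  by rewrite -PrC//; congr Pr; apply/seteqP; split => w /=; rewrite ltNge => /negP.
have Ple : Pr P [set w | X w <= k] = Pr P [set w | X w < k] + Pr P [set w | X w = k].
  have dis : [set w | X w < k] `&` [set w | X w = k] = set0.
    by apply/seteqP; split => // w /= [/[swap] ->]; rewrite ltxx.
  rewrite -(PrU P mlt meq dis).
  congr Pr; apply/seteqP; split => w /=.
    by rewrite le_eqVlt => /predU1P[|]; [right|left].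
  by move=> [/ltW|->].
have Plt := Pr_lt_quantile; rewrite -/k in Plt.
have [|C [mC Ceq PC]] := sierpinski aP meq (_ : 0 <= 1 - p - Pr P [set w |
    k < X w] <= _).
  by rewrite Pgt; apply/andP; split; lra.
exists ([set w | k < X w] `|` C), k; split; first exact: measurableU.
  have dis : [set w | k < X w] `&` C = set0.
    by apply/seteqP; split => // w /= [kX /Ceq/= Xk]; move: kX; rewrite Xk ltxx.
  by rewrite (PrU P mgt mC dis) PC addrC subrK.
split => w /=; first by case => [/ltW//|/Ceq/= ->].
by move=> /not_orP[/negP + _]; rewrite -leNgt.
Qed.

(** On [B] the excess [X - k] is its own positive part, and off [B] the positive part vanishes. The
    right-hand side is the Rockafellar-Uryasev expression, which sees [B] only through its
    probability. *)
Lemma Rintegral_tail (B : set Omega) (k : R) : P.-integrable setT (EFin \o X) ->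
  measurable B -> {ae P, forall w, (B w -> k <= X w) /\ (~ B w -> X w <= k)} ->
  \int[P]_(w in B) X w = k * Pr P B + \int[P]_w Num.max (X w - k) 0.
Proof.
move=> iX mB sB.
have ik (D : set Omega) (r : R) : measurable D -> P.-integrable D (EFin \o cst r).
  by move=> mD; exact: finite_measure_integrable_cst.
have iXB : P.-integrable B (EFin \o X) by apply: integrableS iX.
have iXk : P.-integrable B (EFin \o (fun w => X w - k)).
  rewrite (_ : _ \o _ = ((EFin \o X) \- (EFin \o cst k))%E)//.
  by apply: integrableB => //; exact: ik.
transitivity (\int[P]_(w in B) (cst k w + (X w - k))).
  by apply: eq_Rintegral => w _ /=; rewrite addrC subrK.
rewrite RintegralD//; last exact: ik.
rewrite Rintegral_cst// -/(Pr P B); congr (_ + _).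
rewrite Rintegral_mkcond; congr fine; apply: ae_eq_integral => //.
- apply/measurable_EFinP/(measurable_restrictT _ _).1 => //.
  by apply: measurable_funTS; exact: measurable_funB.
- by apply/measurable_EFinP; apply: measurable_maxr => //; exact: measurable_funB.
apply: filterS sB => w [Bk nBk] _ /=; congr EFin; rewrite patchE.
case: ifPn => [/set_mem/Bk ?|/negP wB]; first by rewrite max_l// subr_ge0.
by rewrite max_r// subr_le0; apply: nBk => /mem_set.
Qed.

End Tail.

(** * The integral of the quantile function over the tail *)

Section QuantileIntegral.
Context (d : measure_display) (Omega : measurableType d) (R : realType)
  (P : probability Omega R).
Variables (X : {RV P >-> R}) (p k : R).
Hypothesis p01 : 0 < p < 1.
Local Notation mu := (@lebesgue_measure R).
Local Notation D := (`]p, 1[%classic : set (measurableTypeR R)).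

Let pos (x : R) : R := Num.max (x - k) 0.

Let mpos : measurable_fun setT pos.
Proof. by apply: measurable_maxr => //; exact: measurable_funB. Qed.

Let pos_ge0 x : 0 <= pos x.
Proof. by rewrite /pos le_max lexx orbT. Qed.

Lemma integral_pos_uquantile :
  (\int[unif01 R]_s (pos (uquantile X s))%:E = \int[P]_w (pos (X w))%:E)%E.
Proof.
have mf : measurable_fun setT (EFin \o pos) by exact/measurable_EFinP.
rewrite -(ge0_integral_distribution X mf); last by move=> y; rewrite lee_fin.
pose q : {mfun measurableTypeR R >-> R} :=
  @mfun_Sub _ _ (measurableTypeR R) R (uquantile X) (mem_set (measurable_uquantile X)).
transitivity (\int[distribution (unif01 R) q]_y (EFin \o pos) y)%E.
  rewrite ge0_integral_pushforward//; by move=> y _; rewrite lee_fin.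
apply: eq_measure_integral => A mA _.
exact: law_uquantile.
Qed.

Lemma integral_unif01_tail (f : R -> R) :
  measurable_fun [set: measurableTypeR R] f -> (forall s, 0 <= f s) ->
  (forall s, 0 < s <= p -> f s = 0) ->
  (\int[unif01 R]_s (f s)%:E = \int[mu]_(s in D) (f s)%:E)%E.
Proof.
move=> mf f0 fp; have [p0 p1] := andP p01.
rewrite integral_uniform//; last exact/measurable_EFinP.
rewrite subr0 invr1 mul1e.
have mfD (A : set (measurableTypeR R)) : measurable_fun A (EFin \o f).
  exact/measurable_funTS/measurable_EFinP.
rewrite -integral_itv_bndo_bndc; last exact: mfD.
rewrite -integral_itv_obnd_cbnd; last exact: mfD.
rewrite -[in RHS](_ : `]0, 1[ `&` `]p, 1[ = `]p, 1[ :> set R)%classic; last first.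
  apply/seteqP; split => s /=; first by case.
  by rewrite !in_itv/= => /andP[ps s1]; rewrite ps s1 (lt_trans p0 ps).
rewrite integral_mkcondr; apply: eq_integral => s;
    rewrite inE/= in_itv/= => /andP[s0 s1].
rewrite patchE; case: ifPn => //; rewrite notin_setE/= in_itv/= s1 andbT => /negP.
by rewrite -leNgt => sp; rewrite fp// s0.
Qed.

Hypothesis iX : P.-integrable setT (EFin \o X).
Hypothesis k_le : forall s, p < s < 1 -> k <= quantile X s.
Hypothesis le_k : forall s, 0 < s <= p -> quantile X s <= k.

(** The counterpart of [Rintegral_tail] for the quantile function, for which [k_le] and [le_k] make
    the interval above [p] a tail event with threshold [k]. The positive part is then carried to
    [Omega] by equality of laws. *)
Lemma Rintegral_quantile :
  \int[mu]_(s in `[p, 1]) quantile X s = k * (1 - p) + \int[P]_w pos (X w).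
Proof.
have [p0 p1] := andP p01.
have muD : mu D = (1 - p)%:E by rewrite lebesgue_measure_itv/= lte_fin p1.
have mq := measurable_uquantile X.
have qE s : p < s < 1 -> quantile X s = uquantile X s.
  by move=> /andP[ps s1]; rewrite /uquantile (lt_trans p0 ps) s1.
have mpq : measurable_fun [set: measurableTypeR R] (pos \o uquantile X).
  exact: measurableT_comp.
have ipos : P.-integrable setT (EFin \o (pos \o X)).
  have iXk : P.-integrable setT ((EFin \o X) \- (EFin \o cst k))%E.
    by apply: integrableB => //; exact: finite_measure_integrable_cst.
  apply: le_integrable iXk => //.
    by apply/measurable_EFinP; exact: measurableT_comp.
  move=> w _ /=; rewrite lee_fin (ger0_norm (pos_ge0 _)) /pos ge_max normr_ge0 andbT.
  exact: ler_norm.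
have eqpos : (\int[mu]_(s in D) (pos (uquantile X s))%:E = \int[P]_w (pos (X w))%:E)%E.
  rewrite -integral_pos_uquantile -integral_unif01_tail// => s /andP[s0 sp].
  rewrite /pos max_r// subr_le0 /uquantile s0 (le_lt_trans sp p1)/=.
  by apply: le_k; rewrite s0.
have iposD : mu.-integrable D (EFin \o (pos \o uquantile X)).
  apply/integrableP; split; first exact/measurable_funTS/measurable_EFinP.
  have /integrableP[_] := ipos.
  under eq_integral do rewrite /= ger0_norm//.
  under [in X in _ -> X]eq_integral do rewrite /= ger0_norm//.
  by rewrite eqpos.
transitivity (\int[mu]_(s in D) (cst k s + pos (uquantile X s))).
  rewrite /Rintegral; congr fine.
  have mqD : measurable_fun D (fun s => (quantile X s)%:E).
    apply: (eq_measurable_fun (EFin \o uquantile X)).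
      by move=> s; rewrite inE/= in_itv/= => ps; rewrite qE.
    exact/measurable_funTS/measurable_EFinP.
  rewrite -integral_itv_obnd_cbnd; last first.
    exact/emeasurable_fun_itv_bndo_bndcP.
  rewrite -integral_itv_bndo_bndc//; apply: eq_integral => s.
  rewrite inE/= in_itv/= => ps; rewrite -qE// /pos max_l ?subr_ge0 ?k_le//.
  by rewrite addrC subrK.
rewrite RintegralD//; last first.
  apply: measurable_bounded_integrable => //; first by rewrite [ltLHS]muD ltry.
  exact: bounded_cst.
rewrite Rintegral_cst//; congr (k * _ + _); last by congr fine.
by rewrite -[RHS]/(fine (1 - p)%:E) -muD.
Qed.

End QuantileIntegral.

(** * Expected Shortfall *)

Section Linf.
Context (d : measure_display) (Omega : measurableType d) (R : realType)
  (P : probability Omega R).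
Implicit Types (X Y : Linf P) (B C : set Omega) (p k : R).

Lemma LinfD X Y w : (X + Y)%R w = X w + Y w.
Proof. by []. Qed.

Lemma Linf_integrable X : P.-integrable setT (EFin \o X).
Proof.
apply/Lfun1_integrable; apply: (@Lfun_subset _ _ _ P 1%E +oo%E) (LfunP X) => //.
- exact: leey.
- exact: fin_num_measure.
- exact: leey.
Qed.

Lemma Linf_integrableS X B : measurable B -> P.-integrable B (EFin \o X).
Proof. by move=> mB; apply: integrableS (Linf_integrable X). Qed.

Lemma bounded_Lfun (f : Omega -> R) (M : R) :
  measurable_fun setT f -> (forall w, `|f w| <= M) -> f \in Lfun P +oo%E.
Proof.
move=> mf fM; rewrite inE; apply/andP; split; rewrite inE//=.
rewrite /finite_norm unlock /=; case: ifPn => [_|]; last by rewrite ltry.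
apply: (@le_lt_trans _ _ M%:E); last exact: ltry.
by apply/ess_supP; apply: aeW => w /=; rewrite lee_fin.
Qed.

Lemma meanE X : mean X = \int[P]_w X w.
Proof. by rewrite /mean unlock. Qed.

Lemma meanD X Y : mean (X + Y)%R = mean X + mean Y.
Proof. by rewrite !meanE -RintegralD//; exact: Linf_integrable. Qed.

Lemma Rintegral_setC X B : measurable B ->
  \int[P]_w X w = \int[P]_(w in B) X w + \int[P]_(w in ~` B) X w.
Proof.
move=> mB; rewrite -Rintegral_setU ?setUv//; first exact: measurableC.
  exact: Linf_integrable.
by rewrite disj_set2E setICr.
Qed.

Lemma le_Pr_ae B C : measurable B -> measurable C ->
  {ae P, forall w, B w -> C w} -> Pr P B <= Pr P C.
Proof.
move=> mB mC [N [mN N0 BCN]].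
rewrite -lee_fin -!PrE// -(measureU0 mC mN N0) le_measure ?inE//.
  exact: measurableU.
move=> w Bw; have [Cw|nCw] := pselect (C w); [by left|right].
by apply: BCN => /= /(_ Bw).
Qed.

Definition ae_separates B X k := {ae P, forall w, (B w -> k <= X w) /\ (~ B w ->
    X w <= k)}.

Lemma separates_ae B X k : separates B X k -> ae_separates B X k.
Proof. by move=> [h1 h2]; apply: aeW => w; split; [exact: h1|exact: h2]. Qed.

Lemma ae_separatesD B X Y k l : ae_separates B X k -> ae_separates B Y l ->
    ae_separates B (X + Y)%R (k + l).
Proof.
apply: filterS2 => w [h1 h2] [g1 g2].
by split => Bw; rewrite LinfD lerD//; [exact: h1|exact: g1|exact: h2|exact: g2].
Qed.

Lemma separates_p_tail_event p B X k : 0 < p < 1 -> measurable B -> Pr P B = 1 - p ->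
  separates B X k -> p_tail_event p X B.
Proof.
move=> /andP[p0 p1] mB PB [h1 h2].
split; last by rewrite PrE// PB.
split => //; rewrite ?PrE// ?PB ?lte_fin; [lra|lra|].
exists (setT, setT) => /=; first by split; exact: filterT.
by move=> [w w'] _ /= Bw nBw'; rewrite (le_trans (h2 _ nBw'))// h1.
Qed.

(** The threshold is the infimum of [X] over the good points of [B]; a good point of the complement,
    which exists as [P B < 1], bounds it from below. *)
Lemma p_tail_event_separates p B X : p_tail_event p X B ->
  [/\ measurable B, Pr P B = 1 - p & exists k, ae_separates B X k].
Proof.
move=> [[mB PB0 PB1 [[Q1 Q2] /= [aQ1 aQ2] Qsep]] PB]; split => //.
  by rewrite /Pr PB.
have ex (A Q : set Omega) : measurable A -> (0 < P A)%E -> {ae P, forall w, Q w} ->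
    exists w, A w /\ Q w.
  move=> mA PA [N [mN N0 QN]]; apply: contrapT => h; move: PA; apply/negP;
      rewrite -leNgt.
  rewrite -N0 le_measure ?inE// => w Aw; apply: QN => Qw; apply: h; by exists w.
have mCB : measurable (~` B) by exact: measurableC.
have [w0 [Bw0 Qw0]] := ex B Q1 mB PB0 aQ1.
have [|w1 [nBw1 Qw1]] := ex (~` B) Q2 mCB _ aQ2.
  by rewrite probability_setC// sube_gt0.
pose S := [set X w | w in B `&` Q1].
have S0 : S !=set0 by exists (X w0), w0.
have lbS w' : ~ B w' -> Q2 w' -> lbound S (X w').
  move=> nBw' Qw' _ [w [Bw Qw] <-]; exact: (Qsep (w, w')).
exists (inf S); apply: filterS2 aQ1 aQ2 => w q1 q2; split => Bw.
  by apply: ge_inf; [exists (X w1); exact: lbS|exists w].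
by apply: lb_le_inf => //; exact: lbS.
Qed.

(** Both sides equal [k] times [1 - p] plus the mean of the positive part of [X - k]. The complement
    of [B] has probability [p], which places the quantiles on the right side of [k]. *)
Lemma ES_tail p B X k : 0 < p < 1 -> measurable B -> Pr P B = 1 - p ->
  ae_separates B X k -> (1 - p) * ES p X = \int[P]_(w in B) X w.
Proof.
move=> p01 mB PB sB; have [p0 p1] := andP p01.
have mC : measurable (~` B) by exact: measurableC.
have PC : Pr P (~` B) = p by rewrite PrC// PB; lra.
rewrite (Rintegral_tail (Linf_integrable X) mB sB) PB /ES mulrA divff ?mul1r; last lra.
apply: (@Rintegral_quantile _ _ _ P X p k p01 (Linf_integrable X)).
- move=> s /andP[ps s1]; rewrite leNgt; apply/negP => qk.
  have : s <= Pr P [set w | X w <= @quantile _ _ _ P X s].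
    by rewrite -lee_fin -cdf_Pr -quantile_le// s1 (lt_trans p0).
  apply/negP; rewrite -ltNge; apply: le_lt_trans ps; rewrite -[leRHS]PC.
  apply: le_Pr_ae => //; first exact: (measurable_RV_itv X `]-oo, @quantile _ _ _ P X
      s]).
  apply: filterS sB => w [h _] /= Xq Bw.
  by have := lt_le_trans (le_lt_trans Xq qk) (h Bw); rewrite ltxx.
- move=> s /andP[s0 sp]; rewrite quantile_le ?s0 ?(le_lt_trans sp)//.
  rewrite cdf_Pr lee_fin (le_trans sp)// -[leLHS]PC.
  apply: le_Pr_ae => //; first exact: (measurable_RV_itv X `]-oo, k]).
  by apply: filterS sB => w [_ h].
Qed.

(** The positive part dominates [X - k] on [C] and 0 off [C]. Tail events reach equality, so they
    maximize the integral among events of their probability. *)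
Lemma Rintegral_le_tail C X k : measurable C ->
  \int[P]_(w in C) X w <= k * Pr P C + \int[P]_w Num.max (X w - k) 0.
Proof.
move=> mC.
have ik (r : R) : P.-integrable C (EFin \o cst r)
    by exact: finite_measure_integrable_cst.
have iXC := Linf_integrableS X mC.
have iXk (D : set Omega) : measurable D -> P.-integrable D (EFin \o (fun w => X w - k)).
  move=> mD; rewrite (_ : _ \o _ = ((EFin \o X) \- (EFin \o cst k))%E)//.
  apply: integrableB => //; first exact: Linf_integrableS.
  exact: finite_measure_integrable_cst.
have imax : P.-integrable setT (EFin \o (fun w => Num.max (X w - k) 0)).
  apply: le_integrable (iXk _ measurableT) => //.
    apply/measurable_EFinP; apply: measurable_maxr => //; exact: measurable_funB.
  move=> w _ /=; rewrite lee_fin ger0_norm ?le_max ?lexx ?orbT//.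
  by rewrite ge_max normr_ge0 ler_norm.
have -> : \int[P]_(w in C) X w = \int[P]_(w in C) (cst k w + (X w - k)).
  by apply: eq_Rintegral => w _ /=; rewrite addrC subrK.
rewrite RintegralD//; last exact: iXk.
rewrite Rintegral_cst// lerD2l Rintegral_mkcond.
apply: le_Rintegral => //.
  rewrite -restrict_EFin; apply/integrable_restrict => //; rewrite setTI; exact: iXk.
move=> w _; rewrite patchE; case: ifPn => _; by rewrite le_max lexx ?orbT.
Qed.

End Linf.

(** * Mean-ES objectives satisfy the axioms *)

Section MeanES.
Context (d : measure_display) (Omega : measurableType d) (R : realType)
  (P : probability Omega R).
Hypothesis atomlessP : atomless P.
Implicit Types (X Y : Linf P) (B C : set Omega) (p k : R).

Definition bounded_mfun (f : Omega -> R) :=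
  measurable_fun setT f /\ exists M, forall w, `|f w| <= M.

Lemma bounded_mfun_Lfun f : bounded_mfun f -> f \in Lfun P +oo%E.
Proof. by move=> [mf [M fM]]; exact: bounded_Lfun fM. Qed.

Definition to_Linf f (bf : bounded_mfun f) : Linf P :=
    Lfun_Sub (leey 1%E) (bounded_mfun_Lfun bf).

Definition two_valued (B : set Omega) (x z : R) (w : Omega) : R :=
    if w \in B then x else z.

Lemma two_valued_in B x z w : B w -> two_valued B x z w = x.
Proof. by move=> Bw; rewrite /two_valued mem_set. Qed.

Lemma two_valued_out B x z w : ~ B w -> two_valued B x z w = z.
Proof. by move=> Bw; rewrite /two_valued memNset. Qed.

Lemma bounded_mfun_two_valued B x z : measurable B -> bounded_mfun (two_valued B x z).
Proof.
move=> mB; split.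
  apply: measurable_fun_ifT => //; apply: (measurable_fun_bool true).
  by rewrite setTI (_ : _ @^-1` _ = B)//;
    apply/seteqP; split => w /=; [exact: set_mem|exact: mem_set].
exists (Num.max `|x| `|z|) => w; rewrite /two_valued.
by case: ifP; rewrite le_max lexx ?orbT.
Qed.

Lemma separates_two_valued B x z : z <= x -> separates B (two_valued B x z) x.
Proof. by move=> zx; split => w Bw; [rewrite two_valued_in|rewrite two_valued_out]. Qed.

Lemma Rintegral_two_valued B x z : measurable B ->
  \int[P]_(w in B) two_valued B x z w = x * Pr P B.
Proof.
move=> mB; rewrite -Rintegral_cst//; apply: eq_Rintegral => w /set_mem Bw.
exact: two_valued_in.
Qed.

Lemma Rintegral_two_valuedC B x z : measurable B ->
  \int[P]_(w in ~` B) two_valued B x z w = z * Pr P (~` B).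
Proof.
move=> mB; rewrite -Rintegral_cst; last exact: measurableC.
by apply: eq_Rintegral => w /set_mem Bw; exact: two_valued_out.
Qed.

Lemma exists_tail_Linf p X : 0 < p < 1 ->
  exists B k, [/\ measurable B, Pr P B = 1 - p & separates B X k].
Proof. by move=> p01; exact: (@exists_tail _ _ _ P X p p01 atomlessP). Qed.

Lemma ES_ge p X C : 0 < p < 1 -> measurable C -> Pr P C = 1 - p ->
  \int[P]_(w in C) X w <= (1 - p) * ES p X.
Proof.
move=> p01 mC PC; have [B [k [mB PB sB]]] := exists_tail_Linf X p01.
rewrite (ES_tail p01 mB PB (separates_ae sB)) (Rintegral_tail (Linf_integrable X)
    mB (separates_ae sB)).
by rewrite PB -PC Rintegral_le_tail.
Qed.

(** The average of [X] over a tail event is at least the threshold, and over its complement at most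
    the threshold. *)
Lemma mean_le_ES p X : 0 < p < 1 -> mean X <= ES p X.
Proof.
move=> p01; have [p0 p1] := andP p01;
    have [B [k [mB PB [kB kC]]]] := exists_tail_Linf X p01.
have mC : measurable (~` B) by exact: measurableC.
have ES_B := ES_tail p01 mB PB (separates_ae (conj kB kC)).
have le1 : k * (1 - p) <= \int[P]_(w in B) X w.
  rewrite -PB -Rintegral_cst//; apply: le_Rintegral => //.
    exact: finite_measure_integrable_cst.
  exact: Linf_integrableS.
have le2 : \int[P]_(w in ~` B) X w <= k * p.
  rewrite (_ : p = Pr P (~` B)); last by rewrite PrC// PB; lra.
  rewrite -Rintegral_cst//; apply: le_Rintegral => //.
    exact: Linf_integrableS.
  exact: finite_measure_integrable_cst.
rewrite -ES_B in le1.
have h1 := ler_wpM2l (ltW p0) le1.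
have h2 : (1 - p) * \int[P]_(w in ~` B) X w <= (1 - p) * (k * p)
    by rewrite ler_pM2l// subr_gt0.
have p1' : 0 < 1 - p by rewrite subr_gt0.
rewrite meanE (Rintegral_setC X mB) -ES_B -(ler_pM2l p1'); lra.
Qed.

(** A tail event of [X] competes in the bound [ES_ge] for [Y]. *)
Lemma le_ES p X Y : 0 < p < 1 -> (forall w, X w <= Y w) -> ES p X <= ES p Y.
Proof.
move=> p01 XY; have [B [k [mB PB sB]]] := exists_tail_Linf X p01.
have p1 : 0 < 1 - p by case/andP: p01; lra.
rewrite -(ler_pM2l p1) (ES_tail p01 mB PB (separates_ae sB)).
apply: le_trans (ES_ge Y p01 mB PB).
by apply: le_Rintegral => //; exact: Linf_integrableS.
Qed.

Lemma le_mean X Y : (forall w, X w <= Y w) -> mean X <= mean Y.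
Proof. by move=> XY; rewrite !meanE le_Rintegral//; exact: Linf_integrable. Qed.

Lemma eq_law_ES p X Y : eq_law X Y -> ES p X = ES p Y.
Proof.
move=> XY; rewrite /ES; congr (_ * _); apply: eq_Rintegral => s _; congr inf.
by apply/seteqP; split => x /=; rewrite /cdf XY.
Qed.

Lemma eq_law_mean X Y : eq_law X Y -> mean X = mean Y.
Proof.
move=> XY; rewrite !meanE; congr fine.
have h (Z : Linf P) : (\int[P]_w (Z w)%:E = \int[distribution P Z]_y (EFin y))%E.
  by rewrite integral_distribution//; exact: Linf_integrable.
by rewrite !h; apply: eq_measure_integral => A mA _; exact: XY.
Qed.

Lemma mean_risk_values_ES p x y : 0 < p < 1 ->
    mean_risk_values (ES (P := P) p) (x, y) <-> y <= x.
Proof.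
move=> p01; have [p0 p1] := andP p01; split.
  by move=> [X _ [<- <-]]; exact: mean_le_ES.
move=> yx; have [B [mB _ PB]] : exists B, [/\ measurable B, B `<=` setT & Pr P B = 1
    - p].
  by apply: sierpinski => //; rewrite PrT; lra.
(* The value off [B] that brings the mean to [y]; it lies below [x] because [y <= x]. *)
pose z := (y - (1 - p) * x) / p.
have zx : z <= x by rewrite /z ler_pdivrMr//; lra.
have zp : z * p = y - (1 - p) * x by rewrite /z mulfVK// gt_eqF.
pose Z := to_Linf (bounded_mfun_two_valued x z mB).
have ESZ : ES p Z = x.
  have := ES_tail p01 mB PB (separates_ae (X := Z) (separates_two_valued B zx)).
  rewrite Rintegral_two_valued// PB mulrC => /mulIf; apply; lra.
exists Z => //; congr (_, _) => //.
rewrite meanE (Rintegral_setC Z mB)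
    Rintegral_two_valued// Rintegral_two_valuedC// PrC// PB.
lra.
Qed.

Lemma ES_D_concentrated p X Y X' Y' : 0 < p < 1 -> p_concentrated p X' Y' ->
  eq_law X X' -> eq_law Y Y' -> ES p (X + Y)%R <= ES p (X' + Y')%R.
Proof.
move=> p01 [B [/p_tail_event_separates[mB PB [k kB]]
    /p_tail_event_separates[_ _ [l lB]]]] XX' YY'.
have p1 : 0 < 1 - p by case/andP: p01; lra.
have [C [m [mC PC sC]]] := exists_tail_Linf (X + Y)%R p01.
have RD (D : set Omega) (Z T : Linf P) : measurable D ->
    \int[P]_(w in D) (Z + T)%R w = \int[P]_(w in D) Z w + \int[P]_(w in D) T w.
  by move=> mD; rewrite -RintegralD//; exact: Linf_integrableS.
rewrite -(ler_pM2l p1) (ES_tail p01 mC PC (separates_ae sC)).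
rewrite (ES_tail p01 mB PB (ae_separatesD kB lB)) !RD//.
rewrite -(ES_tail p01 mB PB kB) -(ES_tail p01 mB PB lB).
by rewrite -(eq_law_ES p XX') -(eq_law_ES p YY') lerD// ES_ge.
Qed.

Lemma mean_ES_axioms p (V : Linf P -> \bar R) (f : R -> R -> \bar R) : 0 < p < 1 ->
  (forall x x' y, y <= x -> y <= x' -> x <= x' -> (f x y <= f x' y)%E) ->
  (forall x y y', y <= x -> y' <= x -> y <= y' -> (f x y <= f x y')%E) ->
  (forall X, V X = f (ES p X) (mean X)) ->
  axiom_M V /\ axiom_CA p V.
Proof.
move=> p01 fx fy VE; split.
  move=> X Y XY; rewrite !VE.
  have mXY := le_mean XY; have eXY := le_ES p01 XY.
  have mX := mean_le_ES X p01; have mY := mean_le_ES Y p01.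
  (* The order of the two moves matters: this corner lies in the domain of [f], whereas
     [(ES p X, mean Y)] may have a mean above its Expected Shortfall. *)
  apply: (@le_trans _ _ (f (ES p Y) (mean X))).
    exact: fx mX (le_trans mX eXY) eXY.
  exact: fy (le_trans mXY mY) mY mXY.
move=> X Y X' Y' cXY XX' YY'; rewrite !VE.
have eqm : mean (X + Y)%R = mean (X' + Y')%R.
  by rewrite !meanD (eq_law_mean XX') (eq_law_mean YY').
have m' := mean_le_ES (X' + Y')%R p01.
have m := mean_le_ES (X + Y)%R p01; rewrite eqm in m; rewrite eqm.
exact: fx m m' (ES_D_concentrated p01 cXY XX' YY').
Qed.

End MeanES.

(** * Recoupling on tail events *)

Section Invariance.
Context (d : measure_display) (Omega : measurableType d) (R : realType)
  (P : probability Omega R).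
Hypothesis atomlessP : atomless P.
Implicit Types (f g : Omega -> R) (B C D : set Omega) (p k : R).

Lemma bounded_mfunD f g : bounded_mfun f -> bounded_mfun g -> bounded_mfun (f \+ g).
Proof.
move=> [mf [M fM]] [mg [N gN]]; split; first exact: measurable_funD.
by exists (M + N) => w; rewrite (le_trans (ler_normD _ _))// lerD.
Qed.

Lemma bounded_mfunN f : bounded_mfun f -> bounded_mfun (\- f).
Proof.
move=> [mf [M fM]]; split; first exact: measurableT_comp.
by exists M => w; rewrite normrN.
Qed.

Lemma bounded_mfunZ a f : bounded_mfun f -> bounded_mfun (fun w => a * f w).
Proof.
move=> [mf [M fM]]; split; first exact: measurable_funM.
by exists (`|a| * M) => w; rewrite normrM ler_wpM2l.
Qed.

Lemma bounded_mfun_integrable f C : bounded_mfun f -> measurable C ->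
    P.-integrable C (EFin \o f).
Proof.
move=> [mf [M fM]] mC; apply: measurable_bounded_integrable => //.
- by rewrite (le_lt_trans (probability_le1 _ _)) ?ltry.
- exact: measurable_funTS.
- by exists M; split=> [|x Mx w _]; [exact: num_real|exact: le_trans (fM w) (ltW Mx)].
Qed.

(** [eq_law] for bare functions, so that recoupling can handle bounded functions without packing
    them into [Linf]. *)
Definition same_law f g := forall S : set R, measurable S ->
    P (f @^-1` S) = P (g @^-1` S).

Lemma same_law_sym f g : same_law f g -> same_law g f.
Proof. by move=> fg S mS; rewrite fg. Qed.

Lemma same_law_comp f g (phi : R -> R) : measurable_fun setT phi -> same_law f g ->
  same_law (phi \o f) (phi \o g).
Proof.
move=> mphi fg S mS; apply: (fg (phi @^-1` S)).
by rewrite -[X in measurable X]setTI; exact: mphi.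
Qed.

Lemma same_law_ae f g : measurable_fun setT f -> measurable_fun setT g ->
  {ae P, forall w, f w = g w} -> same_law f g.
Proof.
move=> mf mg fg S mS.
have mfS : measurable (f @^-1` S) by rewrite -[X in measurable X]setTI; exact: mf.
have mgS : measurable (g @^-1` S) by rewrite -[X in measurable X]setTI; exact: mg.
rewrite !PrE//; congr EFin; apply/eqP; rewrite eq_le !le_Pr_ae//.
  by apply: filterS fg => w /= ->.
by apply: filterS fg => w /= ->.
Qed.

Lemma measurable_two_valued_preimage B (x z : R) (S : set R) : measurable B ->
    measurable (two_valued B x z @^-1` S).
Proof.
move=> mB; rewrite (_ : _ @^-1` _ = (B `&` (if `[< S x >] then setT else set0)) `|`
    (~` B `&` (if `[< S z >] then setT else set0))).
  have mif (b : bool) : measurable (if b then setT else set0 : set Omega) by case: b.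
  by apply: measurableU; apply: measurableI => //; exact: measurableC.
apply/seteqP; split => w /=; have [Bw|nBw] := pselect (B w).
- by rewrite two_valued_in// => Sx; left; split => //; case: asboolP.
- by rewrite two_valued_out// => Sx; right; split => //; case: asboolP.
- by rewrite two_valued_in//; case: asboolP => // ? [[]|[]].
- by rewrite two_valued_out//; case: (asboolP (S z)) => // ? [[]|[]].
Qed.

Lemma Pr_two_valued_preimage D (x z : R) (S : set R) : measurable D ->
  Pr P (two_valued D x z @^-1` S) =
  (if `[< S x >] then Pr P D else 0) + (if `[< S z >] then 1 - Pr P D else 0).
Proof.
move=> mD; rewrite (PrDI P (measurable_two_valued_preimage x z S mD) mD) addrC.
congr (_ + _).
  case: asboolP => Sx; last first.
    rewrite (_ : _ `&` _ = set0) ?Pr0//; apply/seteqP; split => // w /= [+ Dw].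
    by rewrite two_valued_in.
  congr Pr; apply/seteqP; split => w /=; first by case.
  by move=> Dw; rewrite two_valued_in.
case: asboolP => Sx; last first.
  rewrite (_ : _ `\` _ = set0) ?Pr0//; apply/seteqP; split => // w /= [+ Dw].
  by rewrite two_valued_out.
rewrite -PrC//; congr Pr; apply/seteqP; split => w /=; first by case.
by move=> Dw; rewrite two_valued_out.
Qed.

Lemma same_law_two_valued B C (x z : R) : measurable B -> measurable C ->
    Pr P B = Pr P C ->
  same_law (two_valued B x z) (two_valued C x z).
Proof.
move=> mB mC PBC S mS; rewrite !PrE; [|exact: measurable_two_valued_preimage..].
by rewrite !Pr_two_valued_preimage// PBC.
Qed.

Definition common_tail p f g := exists B, [/\ measurable B, Pr P B = 1 - p,
  exists k, separates B f k & exists l, separates B g l].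

(* What [p-CA] yields when both pairs are p-concentrated. *)
Definition coupling_invariant (T : Type) p (W : (Omega -> R) -> T) := forall f g f' g',
  bounded_mfun f -> bounded_mfun g -> bounded_mfun f' -> bounded_mfun g' ->
  common_tail p f g -> common_tail p f' g' -> same_law f f' -> same_law g g' ->
      W (f \+ g) = W (f' \+ g').

Lemma separatesN B f k : separates B f k -> separates (~` B) (\- f) (- k).
Proof.
move=> [h1 h2]; split => w Bw; first by rewrite lerN2; exact: h2.
by rewrite lerN2; apply: h1; exact: contrapT.
Qed.

Lemma separatesD B f g k l : separates B f k -> separates B g l ->
    separates B (f \+ g) (k + l).
Proof.
by move=> [h1 h2] [g1 g2]; split => w Bw /=; rewrite lerD//;
    [exact: h1|exact: g1|exact: h2|exact: g2].
Qed.

(* Exchanges the roles of a tail event and of its complement. *)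
Lemma coupling_invariant_opp (T : Type) p (W : (Omega -> R) -> T) :
  coupling_invariant p W -> coupling_invariant (1 - p) (fun f => W (\- f)).
Proof.
move=> hW f g f' g' bf bg bf' bg' t t' ff' gg'.
have tlN u v : common_tail (1 - p) u v -> common_tail p (\- u) (\- v).
  move=> [B [mB PB [k hk] [l hl]]]; exists (~` B); split.
  - exact: measurableC.
  - by rewrite PrC// PB; lra.
  - by exists (- k); exact: separatesN.
  - by exists (- l); exact: separatesN.
have oppD (u v : Omega -> R) : \- (u \+ v) = (\- u) \+ (\- v).
  by apply/funext => w /=; rewrite opprD.
rewrite !oppD; apply: hW; [exact: bounded_mfunN..|exact: tlN|exact: tlN| |].
- exact: (same_law_comp (phi := -%R)).
- exact: (same_law_comp (phi := -%R)).
Qed.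

(** * Opening a gap at the threshold *)

Section Fixed.
Context (T : Type) (p : R) (W : (Omega -> R) -> T).
Hypothesis p01 : 0 < p < 1.
Hypothesis hW : coupling_invariant p W.

(** Every event separates the constant 0, so [f] and [f'] may each be coupled with it. *)
Lemma coupling_invariant_law f f' B B' k k' : measurable B -> Pr P B = 1 - p ->
  measurable B' -> Pr P B' = 1 - p -> bounded_mfun f -> bounded_mfun f' ->
  separates B f k -> separates B' f' k' -> same_law f f' -> W f = W f'.
Proof.
move=> mB PB mB' PB' bf bf' sf sf' ff'.
have f0 (g : Omega -> R) : g \+ cst 0 = g by apply/funext => w /=; rewrite addr0.
have b0 : bounded_mfun (cst 0 : Omega -> R) by split => //; exists 0 => w;
    rewrite normr0.
have s0 C : separates C (cst 0 : Omega -> R) 0 by split.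
rewrite -[f]f0 -[f']f0; apply: hW => //.
- by exists B; split => //; [exists k|exists 0].
- by exists B'; split => //; [exists k'|exists 0].
Qed.

Lemma coupling_invariant_swap f u v B k l l' : measurable B -> Pr P B = 1 - p ->
  bounded_mfun f -> bounded_mfun u -> bounded_mfun v -> separates B f k ->
      separates B u l -> separates B v l' ->
  same_law u v -> W (f \+ u) = W (f \+ v).
Proof.
move=> mB PB bf bu bv sf su sv uv; apply: hW => //.
- by exists B; split => //; [exists k|exists l].
- by exists B; split => //; [exists k|exists l'].
Qed.

Lemma Rintegral_two_valued_sub B D x : measurable B -> measurable D -> D `<=` B ->
  \int[P]_(w in B) two_valued D x 0 w = x * Pr P D.
Proof.
move=> mB mD DB; rewrite -Rintegral_cst// -{2}(setIidr DB) Rintegral_mkcondr.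
by apply: eq_Rintegral => w _; rewrite patchE.
Qed.

Variable B : set Omega.
Hypotheses (mB : measurable B) (PB : Pr P B = 1 - p).

(** Write [f] as [h] plus [theta] times the indicator of [D], and replace that indicator by the one
    of [C], which has the same law. Both indicators live inside [B], and [h] is still at least [m]
    there, so the two sums are concentrated on [B]. *)
Lemma move_mass f m theta C D : bounded_mfun f -> separates B f m -> 0 <= theta ->
  measurable C -> measurable D -> C `<=` B -> D `<=` B -> Pr P C = Pr P D ->
  (forall w, D w -> m + theta <= f w) ->
  exists g, [/\ bounded_mfun g /\ separates B g m, W g = W f,
    \int[P]_(w in B) g w = \int[P]_(w in B) f w &
    forall w, g w = f w - two_valued D theta 0 w + two_valued C theta 0 w].
Proof.
move=> bf sf th0 mC mD CB DB PCD fD.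
have bD := bounded_mfun_two_valued theta 0 mD;
    have bC := bounded_mfun_two_valued theta 0 mC.
have sepE E : E `<=` B -> separates B (two_valued E theta 0) 0.
  move=> EB; split => w Bw.
    by rewrite /two_valued; case: ifP.
  by rewrite two_valued_out// => /EB.
pose h := f \+ (\- two_valued D theta 0).
have bh : bounded_mfun h by apply: bounded_mfunD => //; exact: bounded_mfunN.
have sh : separates B h m.
  have [f1 f2] := sf; split => w Bw; rewrite /h /=.
    rewrite /two_valued; case: ifPn => [/set_mem/fD|_]; first lra.
    by rewrite subr0; exact: f1.
  by rewrite two_valued_out ?subr0; [exact: f2|move=> /DB].
have fE : f = h \+ two_valued D theta 0.
  by apply/funext => w; rewrite /h /= subrK.
exists (h \+ two_valued C theta 0); split => //.
- split; first exact: bounded_mfunD.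
  by rewrite -[m]addr0; exact: separatesD sh (sepE _ CB).
- rewrite [in RHS]fE; apply: (coupling_invariant_swap mB PB bh bC bD sh (sepE _ CB)
    (sepE _ DB)).
  exact: same_law_two_valued.
- have ih := bounded_mfun_integrable bh mB.
  have iC := bounded_mfun_integrable bC mB; have iD := bounded_mfun_integrable bD mB.
  rewrite [in RHS]fE [LHS](RintegralD mB ih iC) [RHS](RintegralD mB ih iD).
  by rewrite !Rintegral_two_valued_sub// PCD.
Qed.

(* At each step the part of B above the current level pays for a part of equal
   probability below it, so n steps lift all of B. *)
Lemma spread n f m kappa : bounded_mfun f -> separates B f m -> m < kappa ->
  Pr P (B `&` [set w | f w < kappa]) <= n%:R * Pr P (B `&` [set w | kappa <= f w]) ->
  exists g, [/\ bounded_mfun g, W g = W f,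
    \int[P]_(w in B) g w = \int[P]_(w in B) f w,
    forall w, ~ B w -> g w = f w &
    exists2 delta, 0 < delta & forall w, B w -> m + delta <= g w].
Proof.
move: n f kappa.
have mlt f c : bounded_mfun f -> measurable (B `&` [set w | f w < c]).
  move=> [mf _]; apply: measurableI => //.
  rewrite (_ : [set w | _] = f @^-1` `]-oo, c[).
    by rewrite -[X in measurable X]setTI; exact: mf.
  by apply/seteqP; split => w /=; rewrite in_itv.
have mge f c : bounded_mfun f -> measurable (B `&` [set w | c <= f w]).
  move=> [mf _]; apply: measurableI => //.
  rewrite (_ : [set w | _] = f @^-1` `[c, +oo[).
    by rewrite -[X in measurable X]setTI; exact: mf.
  by apply/seteqP; split => w /=; rewrite in_itv/= andbT.
(* When the upper part of [B] is at least as probable as the lower one, a single move lifts the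
   whole lower part. *)
have direct f kappa : bounded_mfun f -> separates B f m -> m < kappa ->
    Pr P (B `&` [set w | f w < kappa]) <= Pr P (B `&` [set w | kappa <= f w]) ->
    exists g, [/\ bounded_mfun g, W g = W f,
      \int[P]_(w in B) g w = \int[P]_(w in B) f w,
      forall w, ~ B w -> g w = f w &
      exists2 delta, 0 < delta & forall w, B w -> m + delta <= g w].
  move=> bf sf mk LH.
  have [|D [mD DH PD]] := sierpinski atomlessP (mge f kappa bf)
      (_ : 0 <= Pr P (B `&` [set w | f w < kappa]) <= _).
    by rewrite Pr_ge0 LH.
  have DB : D `<=` B by move=> w /DH[].
  have th0 : 0 <= (kappa - m) / 2 by lra.
  have [|g [[bg sg] Wg Ig gE]] := move_mass bf sf th0 (mlt f kappa bf) mD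
      (@subIsetl _ _ _) DB (esym PD).
    by move=> w /DH[_ /=]; lra.
  exists g; split => //.
    by move=> w nBw; rewrite gE !two_valued_out ?subr0 ?addr0// => [[]|/DB].
  exists ((kappa - m) / 2); first lra.
  move=> w Bw; rewrite gE; have [fk|kf] := ltP (f w) kappa.
    rewrite [in X in _ <= _ + X]two_valued_in// two_valued_out;
        last by move=> /DH[_ /=]; rewrite leNgt fk.
    by have := sf.1 w Bw; lra.
  rewrite [in X in _ <= _ + X]two_valued_out; last by move=> [_ /=]; rewrite ltNge kf.
  by rewrite /two_valued; case: ifP => _; lra.
elim => [|n IH] f kappa bf sf mk hn.
  by apply: (direct f kappa) => //; rewrite (le_trans hn)// mul0r Pr_ge0.
have [LH|/ltW HL] := leP (Pr P (B `&` [set w | f w < kappa])) (Pr P (B `&` [set w |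
    kappa <= f w])).
  exact: (direct f kappa).
set L := B `&` [set w | f w < kappa] in hn HL.
set H := B `&` [set w | kappa <= f w] in hn HL.
have mL : measurable L by exact: mlt.
have mH : measurable H by exact: mge.
have [|C [mC CL PC]] := sierpinski atomlessP mL (_ : 0 <= Pr P H <= _).
  by rewrite Pr_ge0 HL.
have CB : C `<=` B by move=> w /CL[].
have HB : H `<=` B by move=> w [].
have th0 : 0 <= (kappa - m) / 2 by lra.
have [|g [[bg sg] Wg Ig gE]] := move_mass bf sf th0 mC mH CB HB PC.
  by move=> w [_ /=]; lra.
(* The lowered points of [H] and the raised points of [C] all end at or above this new level, so the
   lower part loses at least the probability of [H], and [n] steps are enough for what remains. *)
pose kappa' := m + (kappa - m) / 2.
have mk' : m < kappa' by rewrite /kappa'; lra.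
have [|h [bh Wh Ih hE [delta d0 hd]]] := IH g kappa' bg sg mk'.
  have sub1 : B `&` [set w | g w < kappa'] `<=` L `\` C.
    move=> w [Bw /= gk]; have [fk|kf] := ltP (f w) kappa.
      split => // Cw; move: gk; rewrite gE [in X in _ + X]two_valued_in//
          two_valued_out.
        by have := sf.1 w Bw; rewrite /kappa'; lra.
      by move=> [_ /=]; rewrite leNgt fk.
    move: gk; rewrite gE two_valued_in// two_valued_out; first by rewrite /kappa'; lra.
    by move=> /CL[_ /=]; rewrite ltNge kf.
  have sub2 : H `<=` B `&` [set w | kappa' <= g w].
    move=> w [Bw /= kf]; split => //=; rewrite gE two_valued_in// two_valued_out;
        first by rewrite /kappa'; lra.
    by move=> /CL[_ /=]; rewrite ltNge kf.
  have le1 := le_Pr P (mlt g kappa' bg) (measurableD mL mC) sub1.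
  have le2 := le_Pr P mH (mge g kappa' bg) sub2.
  have := PrDI P mL mC; rewrite (setIidr CL) PC => PL.
  have le3 := ler_wpM2l (ler0n R n) le2.
  by rewrite -natr1 mulrDl mul1r in hn; lra.
exists h; split => //; [by rewrite Wh|by rewrite Ih| |by exists delta].
move=> w nBw; have nH : ~ H w by move=> /HB.
have nC : ~ C w by move=> /CB.
by rewrite hE// gE !two_valued_out// subr0 addr0.
Qed.

Lemma exists_level f m : bounded_mfun f -> separates B f m ->
  m * Pr P B < \int[P]_(w in B) f w ->
  exists2 kappa, m < kappa & 0 < Pr P (B `&` [set w | kappa <= f w]).
Proof.
move=> bf sf; rewrite -subr_gt0 => I0.
have PB0 : 0 < Pr P B by rewrite PB; case/andP: p01; lra.
set I := \int[P]_(w in B) f w in I0 *.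
(* Half of the mean excess of [f] over [m] on [B]: if [f] were almost surely below [m + e] on [B],
   its integral there would be too small. *)
pose e := (I - m * Pr P B) / (2 * Pr P B).
have e0 : 0 < e by rewrite divr_gt0// mulr_gt0.
have ePB : e * (2 * Pr P B) = I - m * Pr P B by rewrite divfK// gt_eqF// mulr_gt0.
exists (m + e); first by rewrite ltrDl.
have [mf [M fM]] := bf.
set G := B `&` _.
have mG : measurable G.
  apply: measurableI => //; rewrite (_ : [set w | _] = f @^-1` `[m + e, +oo[).
    by rewrite -[X in measurable X]setTI; exact: mf.
  by apply/seteqP; split => w /=; rewrite in_itv/= andbT.
rewrite lt_neqAle Pr_ge0 andbT eq_sym; apply/eqP => G0.
have M0 : 0 <= M + `|m + e|.
  have [w _] : exists w : Omega, True.
    apply: contrapT => no; have := PrT P; rewrite (_ : setT = set0) ?Pr0.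
      by move/eqP; rewrite eq_sym oner_eq0.
    by apply/seteqP; split => // w _; apply: no; exists w.
  by rewrite addr_ge0// (le_trans (normr_ge0 _) (fM w)).
have bk : bounded_mfun (cst (m + e) : Omega -> R) by split => //; exists `|m + e|.
have bG := bounded_mfun_two_valued (M + `|m + e|) 0 mG.
have : I <= \int[P]_(w in B) (cst (m + e) w + two_valued G (M + `|m + e|) 0 w).
  apply: le_Rintegral => //; [exact: bounded_mfun_integrable| |].
    exact: (bounded_mfun_integrable (bounded_mfunD bk bG)).
  move=> w Bw /=; have [fk|kf] := ltP (f w) (m + e).
    by rewrite two_valued_out ?addr0 ?ltW// => -[_ /=]; rewrite leNgt fk.
  rewrite two_valued_in//; have := fM w; rewrite ler_norml => /andP[_].
  have := ler_norm (- (m + e)); rewrite normrN; lra.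
rewrite (RintegralD mB (bounded_mfun_integrable bk mB) (bounded_mfun_integrable bG mB)).
rewrite Rintegral_cst// Rintegral_two_valued_sub//; last exact: subIsetl.
rewrite G0 mulr0 addr0 -/(Pr P B); lra.
Qed.

Lemma gap_above f m : bounded_mfun f -> separates B f m ->
  m * Pr P B < \int[P]_(w in B) f w ->
  exists g, [/\ bounded_mfun g, W g = W f,
    \int[P]_(w in B) g w = \int[P]_(w in B) f w,
    forall w, ~ B w -> g w = f w &
    exists2 delta, 0 < delta & forall w, B w -> m + delta <= g w].
Proof.
move=> bf sf If; have [kappa mk Pk] := exists_level bf sf If.
(* Then [n] times the probability of the upper part exceeds 1, hence also the probability of the
   lower part. *)
pose n := Num.bound (Pr P (B `&` [set w | kappa <= f w]))^-1.
apply: (@spread n f m kappa) => //.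
have hn : (Pr P (B `&` [set w | kappa <= f w]))^-1 < n%:R.
  by rewrite archi_boundP// invr_ge0 ltW.
rewrite -(ltr_pM2r Pk) mulVf ?gt_eqF// in hn.
apply: le_trans (ltW hn); apply: Pr_le1; apply: measurableI => //.
rewrite (_ : [set w | _] = f @^-1` `]-oo, kappa[).
  by rewrite -[X in measurable X]setTI; exact: bf.1.
by apply/seteqP; split => w /=; rewrite in_itv.
Qed.

End Fixed.
End Invariance.

(** * Rotation of a uniform variable *)

Section Rotation.
Context (R : realType).
Local Notation mu := (@lebesgue_measure R).

(** [unif01] is a measure on the whole line; clamping gives a variable with values in the unit
    interval at every point, altered only on a null set. *)
Definition clamp01 (u : R) : R := Num.max 0 (Num.min u 1).

(** Subtraction of [r] modulo 1. *)
Definition rot (r u : R) : R := u - r + (if u < r then 1 else 0).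

Lemma clamp01_id u : 0 <= u < 1 -> clamp01 u = u.
Proof. by move=> /andP[u0 u1]; rewrite /clamp01 min_l ?max_r// ltW. Qed.

Lemma clamp01_itv u : 0 <= clamp01 u <= 1.
Proof. by rewrite /clamp01 le_max lexx/= ge_max ler01/= ge_min lexx orbT. Qed.

Lemma rot_itv r u : 0 <= r <= 1 -> 0 <= u <= 1 -> 0 <= rot r u <= 1.
Proof.
move=> /andP[r0 r1] /andP[u0 u1]; rewrite /rot.
by have [ur|ru] := ltP u r; apply/andP; split; lra.
Qed.

Lemma measurable_clamp01 : measurable_fun [set: R] clamp01.
Proof. by apply: measurable_maxr => //; exact: measurable_minr. Qed.

Lemma measurable_rot d (T : measurableType d) (r u : T -> R) :
  measurable_fun setT r -> measurable_fun setT u ->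
  measurable_fun setT (fun x => rot (r x) (u x)).
Proof.
move=> mr mu'; apply: measurable_funD; first exact: measurable_funB.
by apply: measurable_fun_ifT => //; exact: measurable_fun_ltr.
Qed.

(** The value, free of [r], is the survival function of the uniform law. Points before [r] land
    above [1 - r] and the others below it, whence the cases on [t]. *)
Lemma ray_rot r t : 0 <= r <= 1 ->
  mu ([set u | t < rot r (clamp01 u)] `&` `[0, 1[) =
  (if t < 0 then 1 else if t < 1 then 1 - t else 0)%:E.
Proof.
move=> /andP[r0 r1].
have rotE (u : R) : `[0, 1[%classic u ->
    rot r (clamp01 u) = if u < r then u - r + 1 else u - r.
  by rewrite /= in_itv/= => u01; rewrite clamp01_id// /rot; case: ifP; rewrite ?addr0.
have [t0|t0] := ltP t 0.
  rewrite (_ : _ `&` _ = `[0, 1[%classic).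
    by rewrite lebesgue_measure_itv/= lte_fin ltr01 oppr0 adde0.
  apply/seteqP; split => u /=; first by case.
  move=> u01; split => //; rewrite rotE//; move: u01;
      rewrite /= in_itv/= => /andP[u0 u1].
  by case: (ltP u r) => ?; lra.
have [t1|t1] := ltP t 1; last first.
  rewrite (_ : _ `&` _ = set0) ?measure0//; apply/seteqP; split => // u [/= + u01].
  rewrite rotE//; move: u01; rewrite /= in_itv/= => /andP[u0 u1].
  by case: (ltP u r) => ? ?; exfalso; lra.
have [tr|tr] := leP (1 - r) t.
  rewrite (_ : _ `&` _ = `]t + r - 1, r[%classic).
    rewrite lebesgue_measure_itv/= lte_fin (_ : t + r - 1 < r); last lra.
    by congr EFin; lra.
  apply/seteqP; split => u /=.
    move=> [+ u01]; rewrite rotE//; move: u01; rewrite /= !in_itv/= => /andP[u0 u1].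
    by case: (ltP u r) => ? ?; apply/andP; split; lra.
  rewrite in_itv/= => /andP[h1 h2].
  have u01 : `[0, 1[%classic u by rewrite /= in_itv/=; apply/andP; split; lra.
  split; last exact: u01.
  by rewrite rotE// h2; lra.
rewrite (_ : _ `&` _ = `[0, r[%classic `|` `]t + r, 1[%classic).
  transitivity (mu `[0%R, r[%classic + mu `](t + r)%R, 1%R[%classic)%E.
    apply: measureU => //; apply/seteqP; split => // u [].
    by rewrite /= !in_itv/= => /andP[? ?] /andP[? ?]; exfalso; lra.
  rewrite !lebesgue_measure_itv/= !lte_fin (_ : t + r < 1); last lra.
  by have [h|h] := ltP 0 r; congr EFin; lra.
apply/seteqP; split => u /=.
  move=> [+ u01]; rewrite rotE//; move: u01; rewrite /= !in_itv/= => /andP[u0 u1].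
  by case: (ltP u r) => ? ?; [left; rewrite u0|right; apply/andP; split; lra].
move=> h; have u01 : `[0, 1[%classic u.
  by rewrite /= in_itv/=; case: h; rewrite in_itv/= => /andP[? ?]; apply/andP; split;
      lra.
split; last exact: u01.
by rewrite rotE//; move: u01; rewrite /= in_itv/= => /andP[u0 u1]; case: h;
    rewrite in_itv/= => /andP[? ?]; case: (ltP u r) => ?; lra.
Qed.

Lemma unif01_rot (r : R) (S : set R) : 0 <= r <= 1 -> measurable S ->
  unif01 R [set u | S (rot r (clamp01 u))] = unif01 R [set u | S (clamp01 u)].
Proof.
move=> r01 mS.
have mrot q : measurable_fun [set: measurableTypeR R] (fun u => rot q (clamp01 u)).
  by apply: measurable_rot => //; exact: measurable_clamp01.
have rot0 u : rot 0 (clamp01 u) = clamp01 u.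
  have /andP[u0 _] := clamp01_itv u.
  by rewrite /rot subr0 ltNge u0 addr0.
have -> : [set u | S (clamp01 u)] = [set u | S (rot 0 (clamp01 u))].
  by apply/seteqP; split => u /=; rewrite rot0.
pose q (s : R) : {mfun measurableTypeR R >-> R} :=
  @mfun_Sub _ _ (measurableTypeR R) R _ (mem_set (mrot s)).
suff : distribution (unif01 R) (q r) S = distribution (unif01 R) (q 0) S by [].
have m s t : measurable ([set u | t < rot s (clamp01 u)] : set (measurableTypeR R)).
  rewrite (_ : [set u | _] = setT `&` (fun u => rot s (clamp01 u)) @^-1` `]t, +oo[).
    exact: (mrot s).
  by rewrite setTI; apply/seteqP; split => u /=; rewrite in_itv/= andbT.
apply: prob_ray_eq mS => t.
have E s : 0 <= s <= 1 -> distribution (unif01 R) (q s) `]t, +oo[%classic =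
    (if t < 0 then 1 else if t < 1 then 1 - t else 0)%:E.
  move=> s01; rewrite -(ray_rot t s01) -unif01E//.
  by congr (unif01 R _); apply/seteqP; split => u /=; rewrite in_itv/= andbT.
have e0 : 0 <= (0 : R) <= 1 by rewrite lexx /= ler01.
exact: etrans (E r r01) (esym (E 0 e0)).
Qed.

Lemma unif01_lt (r : R) : 0 <= r <= 1 -> unif01 R [set u | clamp01 u < r] = r%:E.
Proof.
move=> /andP[r0 r1]; rewrite unif01E; last first.
  rewrite (_ : [set u | _] = setT `&` clamp01 @^-1` `]-oo, r[).
    exact: measurable_clamp01.
  by rewrite setTI; apply/seteqP; split => u /=; rewrite in_itv.
rewrite (_ : _ `&` _ = `[0, r[%classic).
  rewrite lebesgue_measure_itv/= lte_fin; case: ltP => [_|];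
      first by rewrite oppr0 adde0.
  by move=> r0'; congr EFin; lra.
apply/seteqP; split => u /=; rewrite !in_itv/=.
  by move=> [ur u01]; rewrite clamp01_id// in ur; rewrite ur andbT; case/andP: u01.
move=> /andP[u0 ur]; have u01 : 0 <= u < 1 by rewrite u0 (lt_le_trans ur).
by rewrite clamp01_id.
Qed.

End Rotation.

(** * Randomization *)

Section Randomize.
Context (d : measure_display) (Omega : measurableType d) (R : realType)
  (P : probability Omega R).
Hypothesis atomlessP : atomless P.
Variables (a b eta : R).
Hypotheses (ab : a < b) (eta0 : 0 < eta).
Implicit Types (f g : Omega -> R) (B : set Omega) (S : set R).
Local Notation Q := (P \x unif01 R)%E.

(** The lower end of the band of [x]: the bands are [[a - eta, a]] and [[b, b + eta]]. *)
Definition base (x : R) := if a < x then b else a - eta.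

(** The relative position of [x] in its band, used as an angle of rotation and as a probability of
    rounding up. *)
Definition rho (x : R) := (x - base x) / eta.

(* For u uniform on [0, 1], tau x u has mean x when x lies in the two bands below. *)
Definition tau (x u : R) := base x + eta * (if u < rho x then 1 else 0).

Definition two_bands (x : R) := (a - eta <= x <= a) \/ (b <= x <= b + eta).

Lemma base_low x : x <= a -> base x = a - eta.
Proof. by rewrite /base ltNge => ->. Qed.

Lemma base_high x : b <= x -> base x = b.
Proof. by move=> bx; rewrite /base (lt_le_trans ab bx). Qed.

Lemma rho_itv x : two_bands x -> 0 <= rho x <= 1.
Proof.
move=> [/andP[h1 h2]|/andP[h1 h2]]; rewrite /rho.
  rewrite base_low// divr_ge0 ?ler_pdivrMr//=; [|lra|exact: ltW].
  lra.
rewrite base_high// divr_ge0 ?ler_pdivrMr//=; [|lra|exact: ltW].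
lra.
Qed.

(** Random rounding is the addition of [eta] times the displacement of [u] under the rotation,
    because [base x] is [x - eta * rho x]. This is what lets recoupling produce it. *)
Lemma tau_rot x u : tau x u = x + eta * (rot (rho x) u - u).
Proof.
rewrite /tau /rot; have -> : base x = x - eta * rho x.
  by rewrite /rho mulrCA divff ?gt_eqF// mulr1; lra.
by lra.
Qed.

Lemma measurable_base : measurable_fun setT base.
Proof. by apply: measurable_fun_ifT => //; exact: measurable_fun_ltr. Qed.

Lemma measurable_rho : measurable_fun setT rho.
Proof.
apply: measurable_funM => //; apply: measurable_funB => //; exact: measurable_base.
Qed.

Lemma measurable_tau d' (T : measurableType d') (x u : T -> R) :
  measurable_fun setT x -> measurable_fun setT u ->
  measurable_fun setT (fun t => tau (x t) (u t)).
Proof.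
move=> mx mu; apply: measurable_funD; first exact: measurableT_comp measurable_base _.
apply: measurable_funM => //; apply: measurable_fun_ifT => //.
by apply: measurable_fun_ltr => //; exact: measurableT_comp measurable_rho _.
Qed.

Lemma product_unif01E (A : Omega -> R -> Prop) :
  Q [set e | A e.1 e.2] = (\int[P]_w unif01 R [set u | A w u])%E.
Proof.
apply: eq_integral => w _ /=; congr (unif01 R _).
by apply/seteqP; split => u; rewrite /xsection /= inE.
Qed.

Lemma product_unif01_fst (A : set Omega) : measurable A -> Q [set e | A e.1] = P A.
Proof.
move=> mA; rewrite (product_unif01E (fun w _ => A w)).
transitivity (\int[P]_w (\1_A w)%:E)%E; last by rewrite integral_indic// setIT.
apply: eq_integral => w _; rewrite indicE; have [Aw|nAw] := boolP (w \in A).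
  rewrite (_ : [set u | _] = setT); first exact: probability_setT.
  by apply/seteqP; split => // u _; exact: set_mem.
rewrite (_ : [set u | _] = set0) ?measure0//.
by apply/seteqP; split => // u Aw; rewrite mem_set in nAw.
Qed.

Lemma measurable_two_bands : measurable [set x | two_bands x].
Proof.
rewrite (_ : [set x | _] = `[a - eta, a] `|` `[b, b + eta])%classic.
  exact: measurableU.
by apply/seteqP; split => x /=; rewrite !in_itv.
Qed.

Lemma unif01_tau x S : two_bands x -> measurable S ->
  unif01 R [set u | S (tau x (clamp01 u))] =
  ((if `[< S (base x + eta) >] then rho x else 0) +
   (if `[< S (base x) >] then 1 - rho x else 0))%:E.
Proof.
move=> xb mS; have r01 := rho_itv xb.
pose D : set (measurableTypeR R) := [set u | clamp01 u < rho x].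
have mD : measurable D.
  rewrite (_ : D = setT `&` clamp01 (R := R) @^-1` `]-oo, rho x[).
    exact: measurable_clamp01.
  by rewrite setTI; apply/seteqP; split => u /=; rewrite in_itv.
have PD : Pr (unif01 R) D = rho x by rewrite /Pr unif01_lt.
rewrite -PD -Pr_two_valued_preimage// -PrE; last exact: measurable_two_valued_preimage.
congr (unif01 R _); apply/seteqP; split => u /=; rewrite /tau /two_valued.
  by case: ifPn => [ux|ux]; rewrite ?mulr1 ?mulr0 ?addr0;
      [rewrite mem_set|rewrite memNset// => /idP; exact/negP].
case: ifPn => [/set_mem|/negP] ux; first by rewrite ux mulr1.
rewrite ifF ?mulr0 ?addr0//; apply/negP => h; apply: ux; exact: mem_set.
Qed.

(* The passage from a copy X of f to tau X U is cut into N increments, each of which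
   replaces eta / N times U by eta / N times its rotation; both are shifted by eta / N
   on the tail event, and the rest of the sum stays concentrated because
   2 eta / N <= b - a. *)
Lemma randomize f B p (T : Type) (W : (Omega -> R) -> T) : coupling_invariant P p W ->
  bounded_mfun f -> measurable B -> Pr P B = 1 - p ->
  (forall w, B w -> b <= f w <= b + eta) ->
  (forall w, ~ B w -> a - eta <= f w <= a) ->
  exists g B', [/\ bounded_mfun g, W g = W f,
    measurable B' /\ Pr P B' = 1 - p, separates B' g b &
    forall S, measurable S ->
      P (g @^-1` S) = (\int[P]_w unif01 R [set u | S (tau (f w) (clamp01 u))])%E].
Proof.
move=> hW bf mB PB fB fC.
have [mf [M fM]] := bf.
have fband w : two_bands (f w).
  by have [/fB|/fC] := pselect (B w); [right|left].
have fgt w : a < f w <-> B w.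
  split => [|/fB/andP[bf' _]]; last exact: lt_le_trans bf'.
  by move=> af; apply: contrapT => /fC/andP[_]; rewrite leNgt af.
pose L := Num.max M 1.
pose h1 (e : Omega * measurableTypeR R) := f e.1.
pose h2 (e : Omega * measurableTypeR R) := clamp01 e.2.
have mh1 : measurable_fun setT h1 by exact: measurableT_comp.
have mh2 : measurable_fun setT h2.
  by apply: measurableT_comp => //; exact: measurable_clamp01.
pose S0 := [set x : R * R | two_bands x.1 /\ 0 <= x.2 <= 1].
have mS0 : measurable S0.
  rewrite (_ : S0 = [set x | two_bands x] `*` `[0, 1]%classic).
    by apply: measurableX => //; exact: measurable_two_bands.
  by apply/seteqP; split => -[x u] /=; rewrite in_itv.
(* [S0] carries the bands and the unit interval over to the copy at every point. *)
have [|||X [U [mX mU XU0 XU]]] :=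
    @realize _ _ _ P atomlessP _ _ [the probability _ _ of Q]
        h1 h2 (- L) L S0 mh1 mh2 _ _ mS0.
- by move=> e; rewrite -ler_norml (le_trans (fM _))// le_max lexx.
- move=> e; rewrite -ler_norml; have /andP[c0 c1] := clamp01_itv e.2.
  by rewrite /h2 ger0_norm// le_max c1 orbT.
- by move=> e; split; [exact: fband|exact: clamp01_itv].
have law1 (A : R -> R -> Prop) : measurable [set x : R * R | A x.1 x.2] ->
    P [set w | A (X w) (U w)] = (\int[P]_w unif01 R [set u | A (f w) (clamp01 u)])%E.
  move=> mA; rewrite -(product_unif01E (fun w u => A (f w) (clamp01 u))).
  exact: XU _ mA.
have mXU (h : R -> R -> R) S : measurable S ->
    measurable_fun setT (fun x : R * R => h x.1 x.2) ->
    measurable [set x : R * R | S (h x.1 x.2)].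
  by move=> mS mh; rewrite -[X in measurable X]setTI; exact: mh.
pose B' := [set w | a < X w].
have mB' : measurable B'.
  rewrite (_ : B' = setT `&` X @^-1` `]a, +oo[); first exact: mX.
  by rewrite setTI; apply/seteqP; split => w; rewrite /B' /= in_itv/= andbT.
have lawX : same_law P X f.
  move=> S mS; transitivity (\int[P]_w unif01 R [set u | S (f w)])%E.
    by apply: (law1 (fun x u => S x));
        exact: (mXU (fun x u => x) S mS (measurable_fst)).
  rewrite -(product_unif01E (fun w u => S (f w))) (@product_unif01_fst (f @^-1` S))//.
  by rewrite -[X in measurable X]setTI; exact: mf.
have PB' : Pr P B' = 1 - p.
  rewrite -PB /Pr; congr fine.
  have -> : B' = X @^-1` `]a, +oo[.
    by apply/seteqP; split => w; rewrite /B' /= in_itv/= andbT.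
  rewrite lawX//; congr (P _); apply/seteqP; split => w /=; rewrite in_itv/= andbT.
    by move=> /fgt.
  by move=> /fgt.
have Xband w : two_bands (X w) by have [] := XU0 w.
have U01 w : 0 <= U w <= 1 by have [] := XU0 w.
have Xhigh w : B' w -> b <= X w.
  by move=> aX; case: (Xband w) => /andP[k1 k2]//; move: aX; rewrite /B' /= ltNge k2.
have Xlow w : ~ B' w -> X w <= a by rewrite /B' /= => /negP; rewrite -leNgt.
pose ro w := rot (rho (X w)) (U w).
have ro01 w : 0 <= ro w <= 1 by apply: rot_itv => //; exact: rho_itv.
have bX : bounded_mfun X.
  split => //; exists (`|a| + `|b| + eta) => w; rewrite ler_norml.
  have := ler_norm a; have := ler_norm b; have := ler_norm (- a);
      have := ler_norm (- b).
  have := normr_ge0 a; have := normr_ge0 b; rewrite !normrN.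
  by case: (Xband w) => /andP[? ?] *; apply/andP; split; lra.
have bU : bounded_mfun U.
  by split => //; exists 1 => w; have /andP[? ?] := U01 w; rewrite ger0_norm.
have mro : measurable_fun setT ro.
  by apply: measurable_rot => //; exact: measurableT_comp measurable_rho _.
have bro : bounded_mfun ro.
  by split => //; exists 1 => w; have /andP[? ?] := ro01 w; rewrite ger0_norm.
pose N := (Num.bound (2 * eta / (b - a))).+1.
pose V (u : Omega -> R) w := (eta / N%:R) * (u w + two_valued B' 1 0 w).
have bV u : bounded_mfun u -> bounded_mfun (V u).
  by move=> bu; apply: bounded_mfunZ; apply: bounded_mfunD => //;
      exact: bounded_mfun_two_valued.
have N0 : (0 : R) < N%:R by rewrite ltr0n.
have eN : 0 < eta / N%:R by rewrite divr_gt0.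
have twoeN : 2 * (eta / N%:R) <= b - a.
  have q0 : 0 <= 2 * eta / (b - a) by rewrite divr_ge0// ?mulr_ge0// ?ltW// subr_gt0.
  rewrite mulrA ler_pdivrMr// -ler_pdivrMl ?subr_gt0// [leLHS]mulrC.
  by rewrite (le_trans (ltW (archi_boundP q0)))// ler_nat.
have sV u : (forall w, 0 <= u w <= 1) -> separates B' (V u) (eta / N%:R).
  move=> u01; split => w Bw; have /andP[u0 u1] := u01 w; rewrite /V.
    by rewrite two_valued_in//; apply: ler_peMr; [exact: ltW|rewrite lerDr].
  by rewrite two_valued_out// addr0; apply: ler_piMr; [exact: ltW|].
have mind : measurable_fun setT (fun x : R * R => if a < x.1 then 1 else 0 : R).
  by apply: measurable_fun_ifT => //; apply: measurable_fun_ltr.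
have indE w : two_valued B' 1 0 w = if a < X w then 1 else 0 :> R.
  by rewrite /two_valued /B'; case: ifPn => [/set_mem/= ->//|/negP h];
      case: ifP => // aX; case: h; exact: mem_set.
(* Given [X], the rotated variable is as uniform as [U], and the shift on [B'] is a function of
   [X]. *)
have eqV : same_law P (V U) (V ro).
  move=> S mS.
  pose ind (x : R) : R := if a < x then 1 else 0.
  have m1 : measurable [set x : R * R | S (eta / N%:R * (x.2 + ind x.1))].
    apply: (mXU (fun x u => eta / N%:R * (u + ind x)) S mS).
    by apply: measurable_funM => //; exact: measurable_funD.
  have m2 : measurable [set x : R * R | S (eta / N%:R * (rot (rho x.1) x.2 + ind x.1))].
    apply: (mXU (fun x u => eta / N%:R * (rot (rho x) u + ind x)) S mS).
    apply: measurable_funM => //; apply: measurable_funD => //.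
    by apply: measurable_rot => //; exact: measurableT_comp measurable_rho _.
  have -> : V U @^-1` S = [set w | S (eta / N%:R * (U w + ind (X w)))].
    by apply/seteqP; split => w /=; rewrite /V indE.
  have -> : V ro @^-1` S = [set w | S (eta / N%:R * (ro w + ind (X w)))].
    by apply/seteqP; split => w /=; rewrite /V indE.
  rewrite [LHS](law1 (fun x u => S (eta / N%:R * (u + ind x))) m1).
  rewrite [RHS](law1 (fun x u => S (eta / N%:R * (rot (rho x) u + ind x))) m2).
  apply: eq_integral => w _.
  pose S' := [set v : R | S (eta / N%:R * (v + ind (f w)))].
  have mS' : measurable S'.
    rewrite -[X in measurable X]setTI.
    have : measurable_fun setT (fun v : R => eta / N%:R * (v + ind (f w))).
      by apply: measurable_funM => //; exact: measurable_funD.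
    exact.
  by rewrite (unif01_rot (rho_itv (fband w)) mS').
pose Y k w := X w + (k%:R / N%:R) * (eta * (ro w - U w)).
have bY k : bounded_mfun (Y k).
  apply: bounded_mfunD => //; do 2 apply: bounded_mfunZ; apply: bounded_mfunD => //;
      exact: bounded_mfunN.
have tauE w : tau (X w) (U w) = X w + eta * (ro w - U w) by rewrite tau_rot.
(* [Y k] is a convex combination of [X] and [tau X U], which lie on the same side of the gap. *)
have sY k : (k <= N)%N -> (forall w, B' w -> b <= Y k w) /\ (forall w, ~ B' w ->
    Y k w <= a).
  move=> kN; have t0 : 0 <= k%:R / N%:R :> R by rewrite divr_ge0.
  have t1 : k%:R / N%:R <= 1 :> R by rewrite ler_pdivrMr// mul1r ler_nat.
  have YE w : Y k w = (1 - k%:R / N%:R) * X w + (k%:R / N%:R) * tau (X w) (U w).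
    by rewrite /Y tauE; move: (_ / _) => t; ring.
  split => w Bw; rewrite YE; move: (k%:R / N%:R) t0 t1 => t t0 t1.
    have k1 := Xhigh w Bw.
    have k2 : b <= tau (X w) (U w).
      rewrite /tau base_high// lerDl; apply: mulr_ge0; first exact: ltW.
      by case: ifP.
    have t1' : 0 <= 1 - t by lra.
  have := ler_wpM2l t0 k2; have := ler_wpM2l t1' k1; lra.
  have k1 := Xlow w Bw.
  have k2 : tau (X w) (U w) <= a.
    have e0 := eta0; rewrite /tau base_low//; case: ifP => _; rewrite ?mulr1 ?mulr0;
        lra.
  have t1' : 0 <= 1 - t by lra.
  have := ler_wpM2l t0 k2; have := ler_wpM2l t1' k1; lra.
have step k : (k < N)%N -> W (Y k.+1) = W (Y k).
  move=> kN; pose A w := Y k w - V U w.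
  have bA : bounded_mfun A by apply: bounded_mfunD => //; apply: bounded_mfunN;
      exact: bV.
  have YkE : Y k = A \+ V U by apply/funext => w; rewrite /A /= subrK.
  have YSE : Y k.+1 = A \+ V ro.
    by apply/funext => w; rewrite /A /= /Y /V -natr1; ring.
  have [s1 s2] := sY k (ltnW kN).
  (* On [B'], [Y k] is at least [b] and [V U] at most [2 * (eta / N)], hence at most [b - a]; off
     [B'], [Y k] is at most [a] and [V U] is nonnegative. *)
  have sA : separates B' A a.
    split => w Bw; have /andP[u0 u1] := U01 w; rewrite /A /V.
      have k1 := s1 w Bw; rewrite two_valued_in//.
      have := ler_wpM2l (ltW eN) (lerD u1 (lexx 1)); lra.
    have k1 := s2 w Bw; rewrite two_valued_out// addr0.
    have := mulr_ge0 (ltW eN) u0; lra.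
  rewrite YkE YSE; apply: (coupling_invariant_swap hW mB' PB' bA (bV _ bro) (bV _ bU)
      sA (sV _ ro01) (sV _ U01)).
  by move=> S mS; rewrite eqV.
have WY k : (k <= N)%N -> W (Y k) = W (Y 0%N).
  by elim: k => // k IH kN; rewrite step// IH// ltnW.
have Y0 : Y 0%N = X by apply/funext => w; rewrite /Y mul0r mul0r addr0.
have YN w : Y N w = tau (X w) (U w) by rewrite /Y tauE divff ?mul1r// gt_eqF.
exists (Y N), B'; split => //.
- have sX : separates B' X b.
    by split; [exact: Xhigh|move=> w Bw; rewrite (le_trans (Xlow w Bw))// ltW].
  have sf : separates B f b.
    split => w Bw; first by case/andP: (fB w Bw).
    by case/andP: (fC w Bw) => _ fa; rewrite (le_trans fa)// ltW.
  by rewrite WY// Y0; exact: (coupling_invariant_law hW mB' PB' mB PB bX bf sX sf lawX).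
- have [s1 s2] := sY N (leqnn N); split => // w Bw.
  by rewrite (le_trans (s2 w Bw))// ltW.
- move=> S mS; rewrite -(law1 (fun x u => S (tau x u))); last first.
    by apply: (mXU tau S mS); exact: measurable_tau.
  by congr (P _); apply/seteqP; split => w /=; rewrite YN.
Qed.

End Randomize.

(** * Averaging on a tail event *)

Section Average.
Context (d : measure_display) (Omega : measurableType d) (R : realType)
  (P : probability Omega R).
Hypothesis atomlessP : atomless P.
Implicit Types (f g : Omega -> R) (B : set Omega) (S : set R).

Lemma bounded_mfunM f g : bounded_mfun f -> bounded_mfun g -> bounded_mfun (f \* g).
Proof.
move=> [mf [M fM]] [mg [N gN]]; split; first exact: measurable_funM.
by exists (M * N) => w; rewrite normrM ler_pM.
Qed.

Lemma bounded_mfun_Rintegral_setC f B : bounded_mfun f -> measurable B ->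
  \int[P]_w f w = \int[P]_(w in B) f w + \int[P]_(w in ~` B) f w.
Proof.
move=> bf mB; rewrite -Rintegral_setU ?setUv//; first exact: measurableC.
  exact: bounded_mfun_integrable.
by rewrite disj_set2E setICr.
Qed.

Lemma Rintegral_affine f B (al be : R) : bounded_mfun f -> measurable B ->
  \int[P]_(w in B) (al + be * f w) = al * Pr P B + be * \int[P]_(w in B) f w.
Proof.
move=> bf mB; have bc : bounded_mfun (cst al : Omega -> R) by split => //; exists `|al|.
rewrite (RintegralD mB (bounded_mfun_integrable P bc mB)
    (bounded_mfun_integrable P (bounded_mfunZ be bf) mB)).
by rewrite (RintegralZl be mB (bounded_mfun_integrable P bf mB)) Rintegral_cst.
Qed.

(** On the band with lower end [c], the probability that the rounding of [x] falls in [S] is affine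
    in [x]; these are its coefficients. *)
Definition slope S (eta c : R) : R := (`[< S (c + eta) >]%:R - `[< S c >]%:R) / eta.

Definition intercept S (eta c : R) : R := `[< S c >]%:R - slope S eta c * c.

(** An affine function on each band integrates to an expression in the integrals of [f] over [B] and
    its complement only. *)
Lemma law_integral (a b eta : R) B S f : a < b -> 0 < eta -> bounded_mfun f ->
    measurable B ->
  measurable S ->
  (forall w, B w -> b <= f w <= b + eta) ->
  (forall w, ~ B w -> a - eta <= f w <= a) ->
  (\int[P]_w unif01 R [set u | S (tau a b eta (f w) (clamp01 u))])%E =
  (intercept S eta b * Pr P B + slope S eta b * \int[P]_(w in B) f w +
   (intercept S eta (a - eta) * Pr P (~` B) +
    slope S eta (a - eta) * \int[P]_(w in ~` B) f w))%:E.
Proof.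
move=> ab eta0 bf mB mS fB fC.
have mC : measurable (~` B) by exact: measurableC.
pose l := two_valued B (intercept S eta b) (intercept S eta (a - eta)) \+
  (two_valued B (slope S eta b) (slope S eta (a - eta)) \* f).
have bl : bounded_mfun l by apply: bounded_mfunD; [|apply: bounded_mfunM => //];
    exact: bounded_mfun_two_valued.
have fband w : two_bands a b eta (f w).
  by have [/fB|/fC] := pselect (B w); [right|left].
transitivity (\int[P]_w (l w)%:E)%E.
  apply: eq_integral => w _; rewrite unif01_tau//; congr EFin.
  have key (c : R) : (if `[< S (c + eta) >] then (f w - c) / eta else 0) +
      (if `[< S c >] then 1 - (f w - c) / eta else 0) =
      intercept S eta c + slope S eta c * f w.
    by rewrite /intercept /slope; case: asboolP => _; case: asboolP => _; rewrite /=;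
        ring.
  rewrite /l /rho /=; have [Bw|nBw] := pselect (B w).
    by rewrite !two_valued_in// base_high// ?key//; case/andP: (fB w Bw).
  by rewrite !two_valued_out// base_low// ?key//; case/andP: (fC w nBw).
rewrite -[LHS]fineK; last exact: (integrable_fin_num measurableT
    (bounded_mfun_integrable P bl measurableT)).
congr EFin; rewrite -/(Rintegral P setT l) (bounded_mfun_Rintegral_setC bl mB);
    congr (_ + _).
  rewrite -(Rintegral_affine _ _ bf mB); apply: eq_Rintegral => w /set_mem Bw.
  by rewrite /l /= !two_valued_in.
rewrite -(Rintegral_affine _ _ bf mC); apply: eq_Rintegral => w /set_mem Bw.
by rewrite /l /= !two_valued_out.
Qed.

Section Fixed.
Context (T : Type) (p : R) (W : (Omega -> R) -> T).
Hypothesis p01 : 0 < p < 1.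
Hypothesis hW : coupling_invariant P p W.

Lemma Rintegral_ge_cst f B (c : R) : bounded_mfun f -> measurable B ->
  (forall w, B w -> c <= f w) -> c * Pr P B <= \int[P]_(w in B) f w.
Proof.
move=> bf mB cf; rewrite -Rintegral_cst//; apply: le_Rintegral => //.
  exact: finite_measure_integrable_cst.
exact: bounded_mfun_integrable.
Qed.

Lemma Rintegral_le_cst f B (c : R) : bounded_mfun f -> measurable B ->
  (forall w, B w -> f w <= c) -> \int[P]_(w in B) f w <= c * Pr P B.
Proof.
move=> bf mB cf; rewrite -Rintegral_cst//; apply: le_Rintegral => //.
  exact: bounded_mfun_integrable.
exact: finite_measure_integrable_cst.
Qed.

Definition average B f : Omega -> R :=
  two_valued B (\int[P]_(w in B) f w / (1 - p)) (\int[P]_(w in ~` B) f w / p).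

(** [f] and its average have equal integrals over [B] and over the complement, so randomizing them
    with the same bands yields the same law. *)
Lemma coupling_invariant_average_gap f B (a b : R) : a < b -> bounded_mfun f ->
    measurable B ->
  Pr P B = 1 - p -> (forall w, B w -> b <= f w) -> (forall w, ~ B w -> f w <= a) ->
  W f = W (average B f).
Proof.
move=> ab bf mB PB fB fC; have [p0 p1] := andP p01.
have p1' : 0 < 1 - p by rewrite subr_gt0.
have mC : measurable (~` B) by exact: measurableC.
have PC : Pr P (~` B) = p by rewrite PrC// PB; lra.
have [_ [M fM]] := bf.
have fM' w : - M <= f w <= M by rewrite -ler_norml.
(* Wide enough for the two bands to contain all values of [f], and hence those of its average. *)
pose eta := `|M| + `|a| + `|b| + 1.
have eta0 : 0 < eta by rewrite /eta; have := normr_ge0 M; have := normr_ge0 a;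
    have := normr_ge0 b; lra.
have [Mb aM] : M <= b + eta /\ a - eta <= - M.
  rewrite /eta; have := ler_norm M; have := ler_norm a; have := ler_norm (- b).
  rewrite normrN; have := normr_ge0 a; have := normr_ge0 b; lra.
set x := \int[P]_(w in B) f w / (1 - p); set z := \int[P]_(w in ~` B) f w / p.
have xE : x * (1 - p) = \int[P]_(w in B) f w by rewrite divfK// gt_eqF.
have zE : z * p = \int[P]_(w in ~` B) f w by rewrite divfK// gt_eqF.
have xb : b <= x <= M.
  apply/andP; split; rewrite -(ler_pM2r p1') xE -PB; first exact: Rintegral_ge_cst.
  by apply: Rintegral_le_cst => // w _; case/andP: (fM' w).
have za : - M <= z <= a.
  apply/andP; split; rewrite -(ler_pM2r p0) zE -PC; last exact: Rintegral_le_cst.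
  by apply: Rintegral_ge_cst => // w _; case/andP: (fM' w).
have bh : bounded_mfun (two_valued B x z) by exact: bounded_mfun_two_valued.
have rf : (forall w, B w -> b <= f w <= b + eta) /\ (forall w, ~ B w ->
    a - eta <= f w <= a).
  split => w Bw; have /andP[? ?] := fM' w.
    by rewrite fB//=; lra.
  by rewrite fC// andbT; lra.
have rh : (forall w, B w -> b <= two_valued B x z w <= b + eta) /\
    (forall w, ~ B w -> a - eta <= two_valued B x z w <= a).
  have /andP[? ?] := xb; have /andP[? ?] := za.
  split => w Bw; first by rewrite two_valued_in//; apply/andP; split; lra.
  by rewrite two_valued_out//; apply/andP; split; lra.
have [g [B1 [bg Wg [mB1 PB1] sg lawg]]] :=
  randomize atomlessP ab eta0 hW bf mB PB rf.1 rf.2.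
have [h [B2 [bh' Wh [mB2 PB2] sh lawh]]] :=
  randomize atomlessP ab eta0 hW bh mB PB rh.1 rh.2.
rewrite -Wg -[average B f]/(two_valued B x z) -Wh.
apply: (coupling_invariant_law hW mB1 PB1 mB2 PB2 bg bh' sg sh) => S mS.
rewrite (lawg S mS) (lawh S mS) [LHS](law_integral ab eta0 bf mB mS rf.1 rf.2).
rewrite [RHS](law_integral ab eta0 bh mB mS rh.1 rh.2).
by rewrite Rintegral_two_valued// Rintegral_two_valuedC// PB PC xE zE.
Qed.

End Fixed.

(** A gap opens above [k] if the average over [B] exceeds [k], below [k] if the average over the
    complement is less than [k]; otherwise [f] equals [k] almost surely. *)
Lemma coupling_invariant_average (T : Type) p (W : (Omega -> R) ->
    T) f B k : 0 < p < 1 ->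
  coupling_invariant P p W -> bounded_mfun f -> measurable B -> Pr P B = 1 - p ->
      separates B f k ->
  W f = W (average p B f).
Proof.
move=> p01 hW bf mB PB sf; have [p0 p1] := andP p01.
have mC : measurable (~` B) by exact: measurableC.
have PC : Pr P (~` B) = p by rewrite PrC// PB; lra.
have [hB|hB] := ltP (k * Pr P B) (\int[P]_(w in B) f w).
  have [g [bg Wg Ig gC [delta d0 gB]]] := gap_above atomlessP p01 hW mB PB bf sf hB.
  have IgC : \int[P]_(w in ~` B) g w = \int[P]_(w in ~` B) f w.
    by apply: eq_Rintegral => w /set_mem; exact: gC.
  rewrite -Wg (coupling_invariant_average_gap p01 hW (_ : k < k + delta) bg mB PB gB).
  - by rewrite /average Ig IgC.
  - by rewrite ltrDl.
  - by move=> w nBw; rewrite gC//; exact: sf.2.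
(* The mirror image of the previous case, with [\- f], the complement of [B] and [1 - p]. *)
have [hC|hC] := ltP (\int[P]_(w in ~` B) f w) (k * Pr P (~` B)).
  have p01' : 0 < 1 - p < 1 by apply/andP; split; lra.
  have PC' : Pr P (~` B) = 1 - (1 - p) by rewrite PC; lra.
  have RN (g : Omega -> R) D : bounded_mfun g -> measurable D ->
      \int[P]_(w in D) (\- g) w = - \int[P]_(w in D) g w.
    move=> bg mD; rewrite -mulN1r -RintegralZl//; last exact: bounded_mfun_integrable.
    by apply: eq_Rintegral => w _; rewrite mulN1r.
  have hC' : - k * Pr P (~` B) < \int[P]_(w in ~` B) (\- f) w.
    by rewrite RN// mulNr ltrN2.
  have [g [bg Wg Ig gB [delta d0 gC]]] :=
      gap_above atomlessP p01' (coupling_invariant_opp hW) mC PC'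
    (bounded_mfunN bf) (separatesN sf) hC'.
  have fNN : \- (\- f) = f by apply/funext => w /=; rewrite opprK.
  rewrite fNN in Wg; rewrite -Wg.
  have gBE w : B w -> (\- g) w = f w.
    by move=> Bw; rewrite /= gB ?opprK//; exact.
  have IB : \int[P]_(w in B) (\- g) w = \int[P]_(w in B) f w.
    by apply: eq_Rintegral => w /set_mem; exact: gBE.
  have IC : \int[P]_(w in ~` B) (\- g) w = \int[P]_(w in ~` B) f w.
    by rewrite RN// Ig RN// opprK.
  rewrite (coupling_invariant_average_gap p01 hW (_ : k - delta < k)
      (bounded_mfunN bg) mB PB).
  - by rewrite /average IB IC.
  - by rewrite ltrBlDr ltrDl.
  - by move=> w Bw; rewrite gBE//; exact: sf.1.
  - by move=> w nBw /=; have := gC w nBw; lra.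
have bk : bounded_mfun (two_valued B k k) by exact: bounded_mfun_two_valued.
have geB := Rintegral_ge_cst bf mB sf.1.
have leC := Rintegral_le_cst bf mC sf.2.
have IB : \int[P]_(w in B) f w = k * Pr P B by apply/eqP; rewrite eq_le hB.
have IC : \int[P]_(w in ~` B) f w = k * Pr P (~` B) by apply/eqP; rewrite eq_le hC leC.
have -> : average p B f = two_valued B k k.
  by rewrite /average IB IC PB PC !mulfK//; lra.
have sk : separates B (two_valued B k k) k by split => w _; rewrite /two_valued if_same.
apply: (coupling_invariant_law hW mB PB mB PB bf bk sf sk).
have [mf _] := bf; have [mk _] := bk.
apply: same_law_ae => //.
(* The absolute value of [f - k], written so that its integrals over [B] and the complement come
   from those of [f]. *)
pose h w := two_valued B 1 (-1) w * f w + two_valued B (- k) k w.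
have bh : bounded_mfun h by apply: bounded_mfunD; [apply: bounded_mfunM => //|];
    exact: bounded_mfun_two_valued.
have hE w : h w = `|f w - k|.
  rewrite /h; have [Bw|nBw] := pselect (B w).
    by rewrite !two_valued_in// ger0_norm ?mul1r// subr_ge0; exact: sf.1.
  by rewrite !two_valued_out// ler0_norm ?subr_le0; [lra|exact: sf.2].
have Ih : \int[P]_w h w = 0.
  rewrite (bounded_mfun_Rintegral_setC bh mB).
  have -> : \int[P]_(w in B) h w = \int[P]_(w in B) (- k + 1 * f w).
    by apply: eq_Rintegral => w /set_mem Bw; rewrite /h !two_valued_in// addrC.
  have -> : \int[P]_(w in ~` B) h w = \int[P]_(w in ~` B) (k + (-1) * f w).
    by apply: eq_Rintegral => w /set_mem Bw; rewrite /h !two_valued_out// addrC.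
  rewrite !Rintegral_affine// IB IC; lra.
have mfk : measurable_fun setT (EFin \o (fun w => f w - k)).
  by apply/measurable_EFinP; exact: measurable_funB.
have /(ae_eq_integral_abs P measurableT mfk) : (\int[P]_w `|(f w - k)%:E| = 0)%E.
  rewrite (eq_integral (EFin \o h)); last by move=> w _ /=; rewrite hE.
  rewrite -[LHS]fineK; last first.
    exact: (integrable_fin_num measurableT (bounded_mfun_integrable P bh measurableT)).
  by congr EFin.
apply: filterS => w /(_ I) [] /eqP; rewrite subr_eq0 => /eqP ->.
by rewrite /two_valued if_same.
Qed.

End Average.

(** * The characterization *)

Section Characterization.
Context (d : measure_display) (Omega : measurableType d) (R : realType)
  (P : probability Omega R).
Hypothesis atomlessP : atomless P.
Variables (p : R) (V : Linf P -> \bar R).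
Hypotheses (p01 : 0 < p < 1) (VM : axiom_M V) (VCA : axiom_CA p V).

(** Evaluates [V] on bare functions; 0 is a default value outside the domain of [V]. *)
Definition on_fun (f : Omega -> R) : \bar R :=
  if pselect (f \in Lfun P +oo%E) is left fL then V (Lfun_Sub (leey 1%E) fL) else 0%E.

Lemma on_funE (X : Linf P) (f : Omega -> R) : X =1 f -> on_fun f = V X.
Proof.
move=> Xf; have fL : f \in Lfun P +oo%E by rewrite -(funext Xf) LfunP.
rewrite /on_fun; case: pselect => // fL'; congr V.
by apply/LfuneqP => w; rewrite Xf.
Qed.

Lemma on_fun_bounded_mfun f (bf : bounded_mfun f) : on_fun f = V (to_Linf P bf).
Proof. exact: on_funE. Qed.

Lemma on_funM f g : bounded_mfun f -> bounded_mfun g -> (forall w, f w <= g w) ->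
  (on_fun f <= on_fun g)%E.
Proof. by move=> bf bg fg; rewrite (on_fun_bounded_mfun bf) (on_fun_bounded_mfun bg);
    exact: VM. Qed.

Lemma on_fun_CA f g f' g' : bounded_mfun f -> bounded_mfun g -> bounded_mfun f' ->
    bounded_mfun g' ->
  common_tail P p f' g' -> same_law P f f' -> same_law P g g' ->
  (on_fun (f \+ g)%R <= on_fun (f' \+ g')%R)%E.
Proof.
move=> bf bg bf' bg' [B [mB PB [k sf] [l sg]]] ff' gg'.
rewrite (@on_funE (to_Linf P bf + to_Linf P bg)%R)//.
rewrite (@on_funE (to_Linf P bf' + to_Linf P bg')%R)//.
apply: VCA; [|exact: ff'|exact: gg'].
exists B; split; first exact: (@separates_p_tail_event _ _ _ P p B (to_Linf P bf') k).
exact: (@separates_p_tail_event _ _ _ P p B (to_Linf P bg') l).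
Qed.

Lemma same_law_refl (f : Omega -> R) : same_law P f f. Proof. by []. Qed.

Lemma coupling_invariant_on_fun : coupling_invariant P p on_fun.
Proof.
move=> f g f' g' bf bg bf' bg' t t' ff' gg'; apply/eqP; rewrite eq_le !on_fun_CA//.
  exact: same_law_sym ff'.
exact: same_law_sym gg'.
Qed.

(** Stated for all of [Linf], whose elements may be unbounded on a null set; it gives access to the
    bounded version of [X]. *)
Lemma eq_law_V (X Y : Linf P) : eq_law X Y -> V X = V Y.
Proof.
move=> XY.
have le (Z T : Linf P) : eq_law Z T -> (V Z <= V T)%E.
  move=> ZT; rewrite -[Z]addr0 -[T]addr0; apply: VCA => //.
  have [B [k [mB PB sB]]] := exists_tail_Linf atomlessP T p01.
  exists B; split; first exact: separates_p_tail_event sB.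
  by apply: (@separates_p_tail_event _ _ _ P p B 0 0).
by apply/eqP; rewrite eq_le !le// => A mA; rewrite XY.
Qed.

Lemma ae_bounded_Linf (X : Linf P) : exists M, {ae P, forall w, `|X w| <= M}.
Proof.
have := LfunP X; rewrite inE => /andP[_]; rewrite inE /= /finite_norm unlock /=.
rewrite probability_setT lte01 => h.
have [M hM] : exists M : R, (ess_sup P (abse \o (EFin \o X)) <= M%:E)%E.
  move: h; case: (ess_sup _ _) => [r _|//|_]; first by exists r.
  by exists 0; exact: leNye.
exists M; move/ess_supP: hM; apply: filterS => w /=.
by rewrite lee_fin.
Qed.

Lemma bounded_version (X : Linf P)
    : exists f (bf : bounded_mfun f), eq_law X (to_Linf P bf).
Proof.
have [M XM] := ae_bounded_Linf X.
have mX : measurable_fun setT X by exact: measurable_funP.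
pose f w := Num.max (- `|M|) (Num.min (X w) `|M|).
have mf : measurable_fun setT f by apply: measurable_maxr => //; exact: measurable_minr.
have bf : bounded_mfun f.
  split => //; exists `|M| => w; rewrite /f ler_norml le_max lexx/=.
  by rewrite ge_max ge_min lexx orbT andbT (le_trans _ (normr_ge0 M))// oppr_le0.
exists f, bf => S mS; apply: (same_law_ae mX mf) => //.
apply: filterS XM => w XM; rewrite /f.
have /andP[h1 h2] : - `|M| <= X w <= `|M|
    by rewrite -ler_norml (le_trans XM)// ler_norm.
by rewrite min_l// max_r.
Qed.

Variable B0 : set Omega.
Hypotheses (mB0 : measurable B0) (PB0 : Pr P B0 = 1 - p).

(** The witness for [f] in the mean-ES optimization. The value off [B0] is the one that gives mean
    [y]; for [y <= x] the event [B0] is a tail event and [x] the Expected Shortfall. *)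
Definition canonical (x y : R) : \bar R :=
  on_fun (two_valued B0 x ((y - (1 - p) * x) / p)).

(** After averaging on [B], law invariance moves the two-valued variable from [B] to the fixed event
    [B0]. *)
Lemma on_fun_canonical f B k : bounded_mfun f -> measurable B -> Pr P B = 1 - p ->
    separates B f k ->
  on_fun f = canonical ((1 - p)^-1 * \int[P]_(w in B) f w) (\int[P]_w f w).
Proof.
move=> bf mB PB sf; have [p0 p1] := andP p01.
have p1' : 0 < 1 - p by rewrite subr_gt0.
have mC : measurable (~` B) by exact: measurableC.
have PC : Pr P (~` B) = p by rewrite PrC// PB; lra.
rewrite (coupling_invariant_average atomlessP p01 coupling_invariant_on_fun bf mB PB
    sf) /average /canonical.
set I := \int[P]_(w in B) f w; set J := \int[P]_(w in ~` B) f w.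
rewrite (bounded_mfun_Rintegral_setC P bf mB)
    -/I -/J mulVKf ?gt_eqF// addrAC subrr add0r.
rewrite [_^-1 * I]mulrC.
have JI : J / p <= I / (1 - p).
  apply: (@le_trans _ _ k).
    by rewrite ler_pdivrMr// -PC; apply: Rintegral_le_cst => //; exact: sf.2.
  by rewrite ler_pdivlMr// -PB; apply: Rintegral_ge_cst => //; exact: sf.1.
apply: (coupling_invariant_law coupling_invariant_on_fun mB PB mB0 PB0
    (bounded_mfun_two_valued _ _ mB) (bounded_mfun_two_valued _ _ mB0)
  (separates_two_valued B JI) (separates_two_valued B0 JI)).
by apply: same_law_two_valued => //; rewrite PB.
Qed.

Lemma V_canonical (X : Linf P) : V X = canonical (ES p X) (mean X).
Proof.
have [f [bf Xf]] := bounded_version X.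
rewrite (eq_law_V Xf) (eq_law_ES p Xf) (eq_law_mean Xf) -on_fun_bounded_mfun.
have [B [k [mB PB sB]]] := exists_tail_Linf atomlessP (to_Linf P bf) p01.
rewrite [LHS](on_fun_canonical bf mB PB sB) meanE; congr canonical.
have p1 : 1 - p != 0 by rewrite gt_eqF// subr_gt0; case/andP: p01.
by rewrite -[\int[P]_(w in B) f w](ES_tail p01 mB PB (separates_ae sB)) mulKf.
Qed.

Lemma canonical_mono_mean x y y' : y <= y' -> (canonical x y <= canonical x y')%E.
Proof.
move=> yy'; apply: on_funM; [exact: bounded_mfun_two_valued..|] => w.
rewrite /two_valued; case: ifP => // _; rewrite ler_pM2r ?lerD2r//.
by rewrite invr_gt0; case/andP: p01.
Qed.

(** Nesting makes [B1] a tail event of every variable that takes one value on [C] and a smaller one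
    off [C]. The last condition says that [C] fills more than half of [B1], so that increasing the
    amplitude of such a variable around a fixed mean increases its Expected Shortfall. *)
Lemma exists_half : exists C B1, [/\ measurable C /\ Pr P C = 2^-1,
  measurable B1 /\ Pr P B1 = 1 - p, B1 `<=` C \/ C `<=` B1 &
  1 - p < 2 * Pr P (C `&` B1)].
Proof.
have [p0 p1] := andP p01.
have [|C [mC _ PC]] := sierpinski atomlessP measurableT (_ : 0 <= (2^-1 : R) <= _).
  by rewrite PrT; apply/andP; split; lra.
have [h|h] := leP (1 - p) 2^-1.
  have [|B1 [mB1 B1C PB1]] := sierpinski atomlessP mC (_ : 0 <= 1 - p <= _).
    by rewrite PC; apply/andP; split; lra.
  exists C, B1; split => //; first by left.
  by rewrite (setIidr B1C) PB1; lra.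
have [|D [mD DC PD]] := sierpinski atomlessP (measurableC mC)
    (_ : 0 <= 1 - p - 2^-1 <= _).
  by rewrite PrC// PC; apply/andP; split; lra.
exists C, (C `|` D); split => //.
- split; first exact: measurableU.
  rewrite PrU// ?PC ?PD; first by rewrite addrC subrK.
  by apply/seteqP; split => // w [Cw /DC].
- by right; exact: subsetUl.
- by rewrite (setIidl (@subsetUl _ _ _)) PC; lra.
Qed.

(* With P C = 1/2 and s <= s', the variable K s' = y + s' on C and y - s' off C is a
   concentrated sum one term of which is (s' - s) 1_C; replacing 1_C by 1_(~ C)
   gives K s. *)
Lemma canonical_mono_ES x x' y : y <= x -> x <= x' ->
    (canonical x y <= canonical x' y)%E.
Proof.
move=> yx xx'; have [p0 p1] := andP p01.
have p1' : 0 < 1 - p by rewrite subr_gt0.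
have [C [B1 [[mC PC] [mB1 PB1] nested half]]] := exists_half.
set r := Pr P (C `&` B1) in half.
have mCC : measurable (~` C) by exact: measurableC.
have sepC (u v : R) : v <= u -> exists k, separates B1 (two_valued C u v) k.
  move=> vu; case: nested => [BC|CB].
    exists u; split => w Bw; first by rewrite two_valued_in//; exact: BC.
    by rewrite /two_valued; case: ifP.
  exists v; split => w Bw; first by rewrite /two_valued; case: ifP.
  by rewrite two_valued_out// => /CB.
(* The average over [B1] of the variable equal to 1 on [C] and to -1 off [C]. *)
pose kap := 2 * r / (1 - p) - 1.
have kap0 : 0 < kap by rewrite /kap subr_gt0 ltr_pdivlMr// mul1r.
pose K a := two_valued C (y + a) (y - a).
have KE a : 0 <= a -> on_fun (K a) = canonical (y + kap * a) y.
  move=> a0; have [|k sK] := sepC (y + a) (y - a); first lra.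
  have bK : bounded_mfun (K a) by exact: bounded_mfun_two_valued.
  have KEE : K a = (fun w => (y - a) + two_valued C (2 * a) 0 w).
    by apply/funext => w; rewrite /K /two_valued; case: ifP => _; lra.
  have IK (D : set Omega) : measurable D ->
      \int[P]_(w in D) K a w = (y - a) * Pr P D + (2 * a) * Pr P (C `&` D).
    move=> mD; rewrite KEE.
    have bc : bounded_mfun (cst (y - a) : Omega -> R) by split => //; exists `|y - a|.
    have bt := bounded_mfun_two_valued (2 * a) 0 mC.
    rewrite (RintegralD mD (bounded_mfun_integrable P bc mD)
        (bounded_mfun_integrable P bt mD)).
    rewrite Rintegral_cst//; congr (_ + _).
    rewrite -Rintegral_cst; last exact: measurableI.
    by rewrite Rintegral_mkcondl; apply: eq_Rintegral => w _; rewrite patchE.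
  rewrite (on_fun_canonical bK mB1 PB1 sK) !IK// PB1 setIT PC PrT -/r.
  congr canonical; last by lra.
  by rewrite mulrDr mulrCA mulVf ?gt_eqF// mulr1 /kap; ring.
(* The amplitude at which [KE] has [x] as first argument of [canonical]. *)
pose a x := (x - y) / kap.
have aE z : z = y + kap * a z.
  by rewrite /a mulrCA divff ?mulr1 ?gt_eqF//; lra.
have a0 z : y <= z -> 0 <= a z by move=> yz; apply: divr_ge0;
    [rewrite subr_ge0|exact: ltW].
have yx' : y <= x' by exact: le_trans xx'.
rewrite {1}(aE x) (aE x') -!KE ?a0//.
have aa : a x <= a x' by rewrite ler_pM2r ?invr_gt0// lerD2r.
have ax0 := a0 _ yx.
move: (a x) (a x') aa ax0 => s s' ss' s0.
have -> : K s' = two_valued C (y + s) (y - s') \+ two_valued C (s' - s) 0.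
  by apply/funext => w; rewrite /K /two_valued /=; case: ifP => _; lra.
have -> : K s = two_valued C (y + s) (y - s') \+ two_valued (~` C) (s' - s) 0.
  apply/funext => w; rewrite /K /=; have [Cw|nCw] := pselect (C w).
    by rewrite !(two_valued_in _ _ Cw) two_valued_out ?addr0// => /(_ Cw).
  by rewrite !(two_valued_out _ _ nCw) two_valued_in//; lra.
apply: on_fun_CA; try exact: bounded_mfun_two_valued.
- have [|k hk] := sepC (y + s) (y - s'); first lra.
  have [|l hl] := sepC (s' - s) 0; first lra.
  by exists B1; split => //; [exists k|exists l].
- exact: same_law_refl.
- by apply: same_law_two_valued => //; rewrite PrC// PC; lra.
Qed.

End Characterization.

Theorem theorem2 (disp : measure_display) (Omega : measurableType disp)
    (R : realType) (P : probability Omega R) (atomlessP : atomless P)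
    (pb : optimization_problem P) :
  mean_ES_optimization pb <->
  axiom_M (objective pb) /\
  exists p : R, 0 < p < 1 /\ axiom_CA p (objective pb).
Proof.
split=> [[p [p01 [f [fNy fx fy VE]]]]|[VM [p [p01 VCA]]]].
  have rangeE x y := @mean_risk_values_ES _ _ _ P atomlessP p x y p01.
  have [VM VCA] : axiom_M (objective pb) /\ axiom_CA p (objective pb).
    apply: (mean_ES_axioms atomlessP p01 _ _ VE).
      by move=> x x' y yx yx'; apply: fx; exact/rangeE.
    by move=> x y y' yx yx'; apply: fy; exact/rangeE.
  by split => //; exists p.
have [|B0 [mB0 _ PB0]] := sierpinski atomlessP measurableT (_ : 0 <= 1 - p <= _).
  by rewrite PrT; case/andP: p01 => ? ?; apply/andP; split; lra.
exists p; split => //; exists (canonical p (objective pb) B0).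
have rangeE x y := @mean_risk_values_ES _ _ _ P atomlessP p x y p01.
split.
- move=> x y _; rewrite /canonical (on_fun_bounded_mfun _ (bounded_mfun_two_valued _
    _ mB0)).
  exact: objective_gtNy.
- by move=> x x' y /rangeE yx _; exact: canonical_mono_ES.
- by move=> x y y' _ _; exact: canonical_mono_mean.
- by move=> X; exact: V_canonical.
Qed.
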